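(* Let $m\in\mathbb{N}$. If $K$ is a compact subset of $\mathcal{T}_m$, then $\Psi_m(K)=\{\Psi(f) : f\in K\}$ is an equicontinuous family of maps $[0,1]\to[0,1]$.
   Context: A continuous map $f:[0,1]\to[0,1]$ is piecewise monotone if $\mathrm{Crit}(f)=\{0,1\}\cup\{x : f \text{ is not monotone on any neighborhood of } x\}$ is finite; the modality of $f$ is the cardinality of $\mathrm{Crit}(f)\cap(0,1)$. $\mathcal{T}$ is the space of continuous, topologically transitive, piecewise monotone maps $[0,1]\to[0,1]$, and $\mathcal{T}_m\subset\mathcal{T}$ is the subspace of maps of modality $m$. All spaces of maps carry the metric $d(f,g)=\max_{x\in[0,1]}|f(x)-g(x)|$. $\mathcal{H}^+$ is the space of increasing homeomorphisms of $[0,1]$ onto itself. A map $f\in\mathcal{T}$ has constant slope $\lambda$ if $|f'(x)|=\lambda$ for all $x\notin\mathrm{Crit}(f)$. It is known that for each $f\in\mathcal{T}$ there are a unique map $\tilde f\in\mathcal{T}$ of some constant slope and a unique $\psi\in\mathcal{H}^+$ with $f=\psi\circ\tilde f\circ\psi^{-1}$, and that the slope of $\tilde f$ is $\exp h(f)$, where $h(f)$ is the topological entropy. Write $\Phi(f)=\tilde f$ (the constant slope model) and $\Psi(f)=\psi$ (the conjugating homeomorphism), so $f=\Psi(f)\circ\Phi(f)\circ\Psi(f)^{-1}$; $\Psi_m:\mathcal{T}_m\to\mathcal{H}^+$ is the restriction of $\Psi$ to $\mathcal{T}_m$. *)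

(* Defs.v *)
From HB Require Import structures.
From mathcomp Require Import all_boot all_order all_algebra.
From mathcomp Require Import all_classical all_reals all_analysis.
Import Order.TTheory GRing.Theory Num.Theory.
Import numFieldNormedType.Exports.

Set Implicit Arguments.
Unset Strict Implicit.
Unset Printing Implicit Defensive.

Local Open Scope classical_set_scope.
Local Open Scope ring_scope.

(* A map [0,1] -> [0,1] is represented by a function R -> R, of which only the
   values on [0,1] matter: every notion below, including the topology of
   [interval_maps] and the domain of equicontinuity, ignores the values taken
   outside [0,1]. *)

Definition unit_itv (R : realType) : set R := `[0, 1]%classic.
Arguments unit_itv : clear implicits.

(* Uniform convergence on [0,1], i.e. the topology of
   d(f,g) = max_{x in [0,1]} |f x - g x|.  Since d ignores the values outside
   [0,1] the space is not Hausdorff, but [compact] does not require separation, so a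
   set is compact iff the corresponding set of restrictions to [0,1] is. *)
Definition interval_maps (R : realType) := {uniform` unit_itv R -> R}.

Section TransitiveMaps.
Variable R : realType.
Local Notation I := (unit_itv R).
Implicit Types (f g psi : R -> R) (A : set R).

Definition monotone_on A f :=
  {in A &, {homo f : x y / x <= y}} \/ {in A &, {homo f : x y /~ x <= y}}.

(* Neighborhoods are taken in [0,1]. *)
Definition Crit f : set R :=
  [set 0; 1] `|`
  [set x | I x /\ ~ exists2 U, nbhs x U & monotone_on (U `&` I) f].

Definition piecewise_monotone f := finite_set (Crit f).

Definition has_modality (m : nat) f := (Crit f `&` `]0, 1[ #= `I_m)%card.

Definition topologically_transitive f :=
  forall U V : set R, open U -> open V ->
    U `&` I !=set0 -> V `&` I !=set0 ->
    exists n : nat, iter n f @` (U `&` I) `&` (V `&` I) !=set0.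

Definition transitive_maps : set (R -> R) :=
  [set f | [/\ set_fun I I f, {within I, continuous f},
               topologically_transitive f & piecewise_monotone f]].

Definition transitive_maps_modality (m : nat) : set (R -> R) :=
  [set f | transitive_maps f /\ has_modality m f].

(* The points of [0,1] outside Crit f lie in ]0,1[, so these are ordinary
   two-sided derivatives, determined by the restriction of f to [0,1]. *)
Definition has_constant_slope f (lambda : R) :=
  forall x, I x -> ~ Crit f x ->
    derivable f x 1 /\ `|derive1 f x| = lambda.

Definition inv_itv psi : R -> R := 'pinv_id I psi.

Definition increasing_homeo : set (R -> R) :=
  [set psi | [/\ set_bij I I psi, {within I, continuous psi},
                 {within I, continuous (inv_itv psi)} &
                 {in I &, {homo psi : x y / x < y}}]].

Definition constant_slope_conjugacy f g psi :=
  [/\ transitive_maps g, (exists lambda, has_constant_slope g lambda),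
      increasing_homeo psi &
      {in I, f =1 psi \o g \o inv_itv psi}].

(* The conjugating homeomorphism, unique on [0,1] for f in [transitive_maps];
   the default value [id] only serves maps outside [transitive_maps]. *)
Definition Psi f : R -> R :=
  xget (id : R -> R) [set psi | exists g, constant_slope_conjugacy f g psi].

End TransitiveMaps.

(* Main.v *)
(* If the conjugacies psi_g of maps g near f in K were not equicontinuous, some
   interval of fixed length would have arbitrarily small measure for the images
   under psi_g of Lebesgue measure, which g multiplies by its slope on every
   interval of monotonicity. Take an ultrafilter of such g, with limit f in K,
   and let Phi be the limit of the distribution functions psi_g^-1. Phi is
   constant on an interval, hence, f being transitive, locally constant off a
   finite set. As the modality is fixed, g has no turning points near points
   where f has none, so there an atom of Phi grows under f by the limit of the
   slopes, and these are bounded away from 1 because a transitive L-Lipschitz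
   map has L^4 >= 2. An atom in ]0,1[ has a preimage in ]0,1[ which is an atom
   and not a turning point; if all atoms are endpoints, each has a preimage which
   is an atom and again an endpoint. Hence an atom of least mass has a preimage
   of smaller mass, a contradiction. *)
Require Import Defs.
From mathcomp Require Import all_boot all_order all_algebra.
From mathcomp Require Import all_classical all_reals all_analysis.
From mathcomp Require Import ring lra.
Import Order.TTheory GRing.Theory Num.Theory.
Import numFieldNormedType.Exports.

Set Implicit Arguments.
Unset Strict Implicit.
Unset Printing Implicit Defensive.

Local Open Scope classical_set_scope.
Local Open Scope ring_scope.

(** * Continuous and Lipschitz functions on closed intervals *)

Section RealFunctions.
Variable R : realType.
Implicit Types (f h T : R -> R) (a b c p s t x y z : R).

(** The main obstacle is that [Phi] may jump, so the relations between [phi g] and [g] do not pass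
    to [Phi] and [f] as they stand. Every estimate is made for [g] near [f], with some room left
    around the images under [f], and only then taken to the limit; the bound [m.+1] on the slopes
    keeps these estimates uniform. An ultrafilter makes all the values [phi g x] converge at once.
    Folding is the other obstacle: at a turning point the images of the two sides overlap and the
    growth of an atom is lost. Interior preimages are therefore taken where the graph of [f] crosses
    a level; the levels 0 and 1 cannot be crossed, which is why endpoints are treated apart. The
    exponent in [L ^+ 4] comes from using one argument twice, for a map and for its second iterate
    on one side of a fixed point, each time with a Lipschitz constant whose square is below 2. *)

Lemma pos_lower_bound3 a b c : 0 < a -> 0 < b -> 0 < c ->
  exists d, [/\ 0 < d, d <= a, d <= b & d <= c].
Proof.
move=> a0 b0 c0; exists (Num.min a (Num.min b c)).
by rewrite !lt_min a0 b0 c0 !ge_min !lexx !orbT.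
Qed.

Lemma exists_between2 p a b : p < a -> p < b -> exists d, [/\ p < d, d <= a & d <= b].
Proof.
move=> pa pb; exists (Num.min a b).
by rewrite lt_min pa pb !ge_min !lexx orbT.
Qed.

Lemma pinch s t a b : s < t -> 0 < a -> 0 < b ->
  exists u v, [/\ s < u, u < v, v < t, u < s + a & t - b < v].
Proof.
move=> st a0 b0; have [|d [d0 da db dt]] := @pos_lower_bound3 a b (t - s) a0 b0.
  by lra.
by exists (s + d / 3), (t - d / 3); split; lra.
Qed.

Lemma within_itv_epsP f a b :
  {within `[a, b], continuous f} <->
  forall x, a <= x <= b -> forall e, 0 < e ->
    exists2 d, 0 < d & forall y, a <= y <= b -> `|x - y| < d -> `|f x - f y| < e.
Proof.
split.
  move=> /subspace_continuousP fc x xab e e0.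
  have /fc/cvgrPdist_lt/(_ _ e0) : `[a, b]%classic x by rewrite /= in_itv.
  rewrite near_withinE => /nbhs_ballP[d /= d0 H].
  exists d => // y yab xy; apply: H => //=; by rewrite in_itv.
move=> H; apply/subspace_continuousP => x; rewrite /= in_itv /= => xab.
apply/cvgrPdist_lt => e /(H _ xab)[d d0 Hd].
rewrite near_withinE; apply/nbhs_ballP; exists d => //= y xy.
rewrite in_itv /=; move/Hd; exact.
Qed.

Lemma within_itvW f a b x y : a <= x -> y <= b ->
  {within `[a, b], continuous f} -> {within `[x, y], continuous f}.
Proof.
move=> ax yb; apply: continuous_subspaceW => t /=; rewrite !in_itv /=.
by move=> /andP[? ?]; apply/andP; split; lra.
Qed.

Lemma ivt f a b x y v : {within `[a, b], continuous f} -> a <= x -> x <= y -> y <= b ->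
  (f x <= v <= f y) || (f y <= v <= f x) -> exists2 c, x <= c <= y & f c = v.
Proof.
move=> fc ax xy yb fv.
have [|c] := @IVT _ f x y v xy (within_itvW ax yb fc).
  by rewrite ge_min le_max; case/orP: fv => /andP[-> ->]; rewrite ?orbT.
by rewrite in_itv /=; exists c.
Qed.

Lemma evt_max f a b x y : {within `[a, b], continuous f} -> a <= x -> x <= y -> y <= b ->
  exists2 c, x <= c <= y & forall t, x <= t <= y -> f t <= f c.
Proof.
move=> fc ax xy yb; have [c] := EVT_max xy (within_itvW ax yb fc).
by rewrite in_itv /= => cxy H; exists c => // t txy; apply: H; rewrite in_itv.
Qed.

Lemma evt_min f a b x y : {within `[a, b], continuous f} -> a <= x -> x <= y -> y <= b ->
  exists2 c, x <= c <= y & forall t, x <= t <= y -> f c <= f t.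
Proof.
move=> fc ax xy yb; have [c] := EVT_min xy (within_itvW ax yb fc).
by rewrite in_itv /= => cxy H; exists c => // t txy; apply: H; rewrite in_itv.
Qed.

Definition lipschitz_itv (L a b : R) f :=
  forall x y, a <= x <= b -> a <= y <= b -> `|f x - f y| <= L * `|x - y|.

Lemma lipschitz_itv_continuous L a b f :
  lipschitz_itv L a b f -> {within `[a, b], continuous f}.
Proof.
move=> fL; apply/within_itv_epsP => x xab e e0.
have L0 : 0 < `|L| + 1 by rewrite ltr_wpDl.
exists (e / (`|L| + 1)); first by rewrite divr_gt0.
move=> y yab; rewrite ltr_pdivlMr// => H.
apply: le_lt_trans (fL _ _ xab yab) _; apply: le_lt_trans H.
rewrite mulrC; apply: ler_wpM2l => //.
by rewrite (le_trans (ler_norm _))// lerDl.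
Qed.

(* A one-sided horseshoe would force expansion by a factor at least 2. *)
Lemma right_trap T L z r : z < r -> L < 2 -> lipschitz_itv L z r T -> T z = z ->
  (exists2 e, 0 < e & forall x, z < x <= z + e -> x <= r -> z < T x) ->
  (exists M, [/\ z < M, M < r & forall x, z < x <= M -> z < T x <= M]) \/
  (forall x, z < x <= r -> z < T x).
Proof.
move=> zr L2 TL Tz [e e0 He].
have [[y yS]|nS] := pselect (exists y, z < y <= r /\ T y <= z); last first.
  right=> x xr; rewrite ltNge; apply/negP => Tx; apply: nS; by exists x.
left; pose S := [set y | z < y <= r /\ T y <= z].
have Slb : lbound S (z + e).
  move=> x [/andP[zx xr] Tx]; rewrite leNgt; apply/negP => xe.
  by have := He x; lra.
have hS : has_inf S by split; [exists y|exists (z + e)].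
set b := inf S.
have bz : z + e <= b by apply: lb_le_inf => //; exists y.
have br : b <= r by apply: le_trans (_ : y <= _); [apply: ge_inf => //; case: hS|lra].
have Lpos : 0 < L.
  have [||x [zx xr xe]] := @exists_between2 z r (z + e); try lra.
  have := He x; have := TL x z; rewrite Tz => H1 H2.
  have {H1} : `|T x - z| <= L * `|x - z| by apply: H1; lra.
  rewrite ger0_norm; last by lra.
  rewrite ger0_norm; last by lra.
  have : z < T x by apply: H2; lra.
  by move=> ? H; rewrite -(pmulr_lgt0 _ (_ : 0 < x - z)); lra.
have Tb : T b <= z.
  apply/ler_addgt0Pr => d d0.
  have dL : 0 < d / L by rewrite divr_gt0.
  have [s Ss sb] := inf_adherent dL hS.
  rewrite -/b in sb; have bs : b <= s by apply: ge_inf => //; case: hS.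
  case: Ss => srz Ts; have := TL b s; rewrite ler_norml ler0_norm; last by lra.
  move=> /(_ _ _)/andP[||_]; try lra.
  have : (s - b) * L < d by rewrite -ltr_pdivlMr//; lra.
  lra.
have Tpos x : z < x -> x < b -> z < T x.
  move=> zx xb; rewrite ltNge; apply/negP => Tx.
  suff : b <= x by lra.
  apply: ge_inf; first by case: hS.
  by split => //; lra.
(* On [[z, b]] both [L * (x - z)] and [L * (b - x)] bound [T x - z], hence so does their mean
   [L * (b - z) / 2], which is below [b - z] because [L < 2]. *)
have M1 : L * (b - z) / 2 < b - z.
  by rewrite ltr_pdivrMr// mulrC ltr_pM2l; lra.
have M0 : 0 < L * (b - z) / 2 by rewrite divr_gt0// mulr_gt0//; lra.
exists (z + L * (b - z) / 2); split; [lra|lra|].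
move=> x /andP[zx xM]; rewrite Tpos//=; last by lra.
have := TL x z; rewrite Tz ler_norml ger0_norm; last by lra.
move=> /(_ _ _)/andP[||_ H1]; try lra.
have := TL x b; rewrite ler_norml ler0_norm; last by lra.
move=> /(_ _ _)/andP[||_ H2]; try lra.
Qed.

End RealFunctions.

(** * A lower bound for the Lipschitz constant of a transitive map *)

Section LipschitzTransitive.
Variable R : realType.
Implicit Types (f h T : R -> R) (a b c p r x y z : R).

Definition self_map p r h := forall x, p <= x <= r -> p <= h x <= r.

(** Discreteness of the fibres; it gives [h x - z] a constant sign on either side close to a fixed
    point [z]. *)
Definition light p r h := forall x, p <= x <= r ->
  exists2 e, 0 < e & forall y, p <= y <= r -> 0 < `|y - x| < e -> h y != h x.

(** The consequence of transitivity that is used here, density of invariant sets with interior. It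
    passes to the second iterate on one side of a fixed point whose sides are swapped. *)
Definition trap_free p r h := forall (E : set R) u1 u2 v1 v2,
  E `<=` `[p, r] -> (forall x, E x -> E (h x)) ->
  u1 < u2 -> (forall x, u1 < x < u2 -> E x) ->
  p <= v1 -> v1 < v2 -> v2 <= r -> exists2 x, v1 < x < v2 & E x.

Definition trap_free_lipschitz L p r h :=
  [/\ self_map p r h, lipschitz_itv L p r h, light p r h & trap_free p r h].

Lemma trap_free_lipschitz_opp L p r h : trap_free_lipschitz L p r h ->
  trap_free_lipschitz L (- r) (- p) (fun x => - h (- x)).
Proof.
move=> [hs hL hl ht]; split.
- by move=> x xpr; have := hs (- x); lra.
- move=> x y xpr ypr; rewrite -opprD normrN -[`|x - y|]normrN opprD.
  by apply: hL; lra.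
- move=> x xpr; have [|e e0 He] := hl (- x); first by lra.
  exists e => // y ypr xy; rewrite eqr_opp; apply: He; first by lra.
  by rewrite -opprD normrN.
- move=> E u1 u2 v1 v2 Epr Eh u12 uE pv1 v12 v2r.
  have [|||||||x xv Ex] := ht [set x | E (- x)] (- u2) (- u1) (- v2) (- v1); try lra.
  + by move=> x /Epr; rewrite /= !in_itv /=; lra.
  + by move=> x /= /Eh; rewrite opprK.
  + by move=> x xu; apply: uE; lra.
  + by exists (- x) => //; lra.
Qed.

Lemma light_right_sign p r h z : {within `[p, r], continuous h} -> light p r h ->
  p <= z -> z < r -> h z = z ->
  (exists2 e, 0 < e & forall x, z < x <= z + e -> x <= r -> z < h x) \/
  (exists2 e, 0 < e & forall x, z < x <= z + e -> x <= r -> h x < z).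
Proof.
move=> hc hl pz zr hz; have [|e e0 He] := hl z; first by lra.
have e20 : 0 < e / 2 by lra.
have hn x : z < x <= z + e / 2 -> x <= r -> h x != z.
  move=> xz xr; rewrite -[X in _ != X]hz; apply: He; first by lra.
  by rewrite gtr0_norm; lra.
have [H|] := pselect (forall x, z < x <= z + e / 2 -> x <= r -> z < h x).
  by left; exists (e / 2).
move=> /existsNP[x0] /not_implyP[x0z] /not_implyP[x0r] /negP; rewrite -leNgt => hx0.
right; exists (e / 2) => // x xz xr; rewrite ltNge; apply/negP => hx.
have [xx|xx] := leP x0 x.
- have [||||c cx hcz] := @ivt _ h p r x0 x z hc; [lra|lra|lra|lra|].
  by have := hn c; rewrite hcz eqxx => /(_ _ _)/negP[]; lra.
- have [||||c cx hcz] := @ivt _ h p r x x0 z hc; [lra|lra|lra|lra|].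
  by have := hn c; rewrite hcz eqxx => /(_ _ _)/negP[]; lra.
Qed.

(** Otherwise [right_trap] makes [[z, M]] or [[z, r]] invariant, and both miss the points left of
    [z]. *)
Lemma trap_free_not_right L p r h z : L < 2 -> trap_free_lipschitz L p r h ->
  p < z -> z < r -> h z = z ->
  ~ exists2 e, 0 < e & forall x, z < x <= z + e -> x <= r -> z < h x.
Proof.
move=> L2 [hs hL hl ht] pz zr hz H.
have hL' : lipschitz_itv L z r h by move=> x y ? ?; apply: hL; lra.
have [[M [zM Mr HM]]|HM] := right_trap zr L2 hL' hz H.
- have [|||||||x xv] := ht `[z, M]%classic z M p z; [| |lra| |lra|lra|lra|].
  + by move=> x; rewrite /= !in_itv /=; lra.
  + move=> x; rewrite /= !in_itv /= => xz; have [->|xz'] := eqVneq x z.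
      by rewrite hz; lra.
    have := HM x; rewrite !lt_neqAle eq_sym xz'; lra.
  + by move=> x ?; rewrite /= in_itv /=; lra.
  + by rewrite /= in_itv /=; lra.
- have [|||||||x xv] := ht `[z, r]%classic z r p z; [| |lra| |lra|lra|lra|].
  + by move=> x; rewrite /= !in_itv /=; lra.
  + move=> x; rewrite /= !in_itv /= => xz; have [->|xz'] := eqVneq x z.
      by rewrite hz; lra.
    by have := HM x; have := hs x; rewrite !lt_neqAle eq_sym xz'; lra.
  + by move=> x ?; rewrite /= in_itv /=; lra.
  + by rewrite /= in_itv /=; lra.
Qed.

Lemma trap_free_not_left L p r h z : L < 2 -> trap_free_lipschitz L p r h ->
  p < z -> z < r -> h z = z ->
  ~ exists2 e, 0 < e & forall x, z - e <= x < z -> p <= x -> h x < z.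
Proof.
move=> L2 /trap_free_lipschitz_opp Hh pz zr hz [e e0 He].
apply: (trap_free_not_right L2 Hh (_ : - r < - z)); rewrite ?ltrN2 ?opprK ?hz//.
by exists e => // x xz xp; rewrite ltrN2; apply: He; lra.
Qed.

(** Near [z] the map exchanges the two sides, so [h \o h] keeps the right side on the right there,
    and [right_trap] applies to it with constant [L * L]. If it traps [[z, M]], then [[z, M]]
    together with its image under [h] is invariant and misses the points right of [M]. If it keeps
    all of []z, r]] right of [z], then [h] cannot take the value [z] there, since such a point would
    be sent to [z] by [h \o h]. *)
Lemma trap_free_right L p r h z : 0 <= L -> L * L < 2 -> trap_free_lipschitz L p r h ->
  p < z -> z < r -> h z = z -> forall x, z < x <= r -> h x < z.
Proof.
move=> L0 LL2 Hh pz zr hz; have L2 : L < 2 by nra.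
have [hs hL hl ht] := Hh; have hc := lipschitz_itv_continuous hL.
have [e e0 He] : exists2 e, 0 < e & forall x, z < x <= z + e -> x <= r -> h x < z.
  have [|H|//] := light_right_sign hc hl _ zr hz; first by lra.
  by have := trap_free_not_right L2 Hh pz zr hz H.
have [e' e'0 He'] : exists2 e, 0 < e & forall x, z - e <= x < z -> p <= x -> z < h x.
  have [hs' hL' hl' ht'] := trap_free_lipschitz_opp Hh.
  have := light_right_sign (lipschitz_itv_continuous hL') hl' (_ : - r <= - z).
  rewrite !lerN2 !ltrN2 !opprK hz => /(_ (ltW zr) pz erefl)[[d d0 Hd]|[d d0 Hd]].
    exfalso; apply: (trap_free_not_left L2 Hh pz zr hz).
    exists d => // x xz xp; have := Hd (- x); rewrite opprK => H.
    suff: - z < - h x by lra.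
    by apply: H; lra.
  exists d => // x xz xp; have := Hd (- x); rewrite opprK => H.
  suff: - h x < - z by lra.
  by apply: H; lra.
pose T x := h (h x).
have TL : lipschitz_itv (L * L) z r T.
  move=> x y xr yr; have xr' : p <= x <= r by lra.
  have yr' : p <= y <= r by lra.
  apply: le_trans (hL _ _ (hs _ xr') (hs _ yr')) _; rewrite -mulrA.
  by apply: ler_wpM2l => //; apply: hL.
have Tz : T z = z by rewrite /T !hz.
have Tr : exists2 e, 0 < e & forall x, z < x <= z + e -> x <= r -> z < T x.
  have zpr : p <= z <= r by lra.
  have /within_itv_epsP/(_ z zpr _ e'0)[d d0 Hd] := hc.
  have [||m [m0 m1 m2]] := @exists_between2 _ 0 e (d / 2); [lra|lra|].
  exists m => // x xz xr; have hxz : h x < z by apply: He; lra.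
  have /andP[h1 h2] : - e' < z - h x < e'.
    rewrite -ltr_norml -[X in X - _]hz; apply: Hd; first by lra.
    by rewrite ltr0_norm; lra.
  by apply: He'; have := hs x; lra.
have hneg b : b <= r -> (forall x, z < x <= b -> z < T x) -> forall x, z < x <= b -> h x < z.
  move=> br HT x xz; rewrite ltNge; apply/negP => hx.
  have [||y [y0 y1 y2]] := @exists_between2 _ z x (z + e); [lra|lra|].
  have hy : h y < z by apply: He; lra.
  have [||||c cx hcz] := @ivt _ h p r y x z hc; [lra|lra|lra|lra|].
  by have := HT c; rewrite /T hcz hz; lra.
have [[M [zM Mr HM]]|HM] := right_trap zr LL2 TL Tz Tr; last exact: hneg.
have hM : forall x, z < x <= M -> h x < z by apply: hneg; [lra|move=> x /HM; lra].
exfalso.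
have [|||||||x xv] := ht [set x | z <= x <= M \/ exists2 y, z <= y <= M & x = h y] z M M r; [| |lra| |lra|lra|lra|].
- move=> x [|[y yz ->]]; rewrite /= in_itv /=; first by lra.
  by apply: hs; lra.
- move=> x [xz|[y yz ->]]; first by right; exists x.
  left; have [->|yz'] := eqVneq y z; first by rewrite !hz; lra.
  by have := HM y; rewrite /T !lt_neqAle eq_sym yz'; lra.
- by move=> x ?; left; lra.
- case; first by lra.
  move=> [y yz xy]; have [yz'|yz'] := eqVneq y z; first by rewrite yz' hz in xy; lra.
  by have := hM y; rewrite lt_neqAle eq_sym yz' -xy; lra.
Qed.

(** Without an interior fixed point [h] moves the midpoint to one side, and every point of the half
    on that side moves the same way or stays, so that half is a trap. *)
Lemma trap_free_swap L p r h : p < r -> 0 <= L -> L * L < 2 -> trap_free_lipschitz L p r h ->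
  exists z, [/\ p < z < r, h z = z, forall x, z < x <= r -> h x < z
    & forall x, p <= x < z -> z < h x].
Proof.
move=> pr L0 LL2 Hh; have [hs hL hl ht] := Hh; have hc := lipschitz_itv_continuous hL.
have hd : {within `[p, r], continuous (fun x => h x - x)}.
  apply: (@lipschitz_itv_continuous _ (L + 1)) => x y xr yr.
  have -> : h x - x - (h y - y) = (h x - h y) + (y - x) by ring.
  by rewrite mulrDl mul1r (le_trans (ler_normD _ _))// [`|y - x|]distrC lerD2r hL.
have [z zpr hz] : exists2 z, p < z < r & h z = z.
  apply: contrapT => nz; have [m pm mr] : exists2 m, p < m & m < r.
    by exists ((p + r) / 2); lra.
  have [hm|hm] := leP (h m) m.
  - have Hle x : p <= x <= m -> h x <= x.
      move=> xm; rewrite leNgt; apply/negP => hx.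
      have hm' : h m < m.
        rewrite lt_neqAle hm andbT; apply/negP => /eqP hm0; apply: nz; exists m => //.
        by lra.
      have [||||c cx hcz] := @ivt _ _ p r x m 0 hd; [lra|lra|lra|rewrite /=; lra|].
      have [cp|cp] := eqVneq c x; first by rewrite cp in hcz; lra.
      apply: nz; exists c; last by lra.
      by move: cp; rewrite neq_lt; lra.
    have [|||||||x xv] := ht `[p, m]%classic p m m r; [| |lra| |lra|lra|lra|].
    + by move=> x; rewrite /= !in_itv /=; lra.
    + move=> x; rewrite /= !in_itv /= => xp; have := Hle _ xp.
      by have := hs x; lra.
    + by move=> x ?; rewrite /= in_itv /=; lra.
    + by rewrite /= in_itv /=; lra.
  - have Hle x : m <= x <= r -> x <= h x.
      move=> xm; rewrite leNgt; apply/negP => hx.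
      have [||||c cx hcz] := @ivt _ _ p r m x 0 hd; [lra|lra|lra|rewrite /=; lra|].
      have [cp|cp] := eqVneq c x; first by rewrite cp in hcz; lra.
      apply: nz; exists c; last by lra.
      by move: cp; rewrite neq_lt; lra.
    have [|||||||x xv] := ht `[m, r]%classic m r p m; [| |lra| |lra|lra|lra|].
    + by move=> x; rewrite /= !in_itv /=; lra.
    + move=> x; rewrite /= !in_itv /= => xp; have := Hle _ xp.
      by have := hs x; lra.
    + by move=> x ?; rewrite /= in_itv /=; lra.
    + by rewrite /= in_itv /=; lra.
exists z; split => //; first by apply: trap_free_right Hh _ _ hz => //; lra.
have H : forall x, - z < x <= - p -> - h (- x) < - z.
  by apply: (trap_free_right L0 LL2 (trap_free_lipschitz_opp Hh)); rewrite ?opprK ?hz//; lra.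
move=> x xz; have := H (- x); rewrite opprK => H'.
suff: - h x < - z by lra.
by apply: H'; lra.
Qed.

(** Below this bound [h] swaps the sides of a fixed point [z], and [h \o h] acts on [[z, r]] with
    constant [L * L], where it swaps the sides of an interior fixed point [z'] in turn. But [z] lies
    left of [z'] and is itself fixed. *)
Lemma trap_free_lipschitz_ge L p r h : p < r -> 0 <= L -> trap_free_lipschitz L p r h -> 2 <= L ^+ 4.
Proof.
move=> pr L0 Hh; rewrite leNgt; apply/negP => L4.
have LL4 : (L * L) * (L * L) < 2.
  by have -> : (L * L) * (L * L) = L ^+ 4 by ring.
have LL2 : L * L < 2 by nra.
have [z [zpr hz hr hl]] := trap_free_swap pr L0 LL2 Hh.
have [hs hL hli ht] := Hh; have hc := lipschitz_itv_continuous hL.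
have h_right x : z <= x <= r -> p <= h x <= z.
  move=> xz; have [->|xz'] := eqVneq x z; first by rewrite hz; lra.
  by have := hr x; have := hs x; rewrite !lt_neqAle eq_sym xz'; lra.
have h_left x : p <= x <= z -> z <= h x <= r.
  move=> xz; have [->|xz'] := eqVneq x z; first by rewrite hz; lra.
  by have := hl x; have := hs x; rewrite !lt_neqAle xz'; lra.
have HT : trap_free_lipschitz (L * L) z r (h \o h).
  split.
  - by move=> x xz /=; apply: h_left; apply: h_right.
  - move=> x y xr yr; have xr' : p <= x <= r by lra.
    have yr' : p <= y <= r by lra.
    apply: le_trans (hL _ _ (hs _ xr') (hs _ yr')) _; rewrite -mulrA.
    by apply: ler_wpM2l => //; apply: hL.
  - move=> x xz; have xr' : p <= x <= r by lra.
    have [e1 e10 He1] := hli _ xr'; have [e2 e20 He2] := hli _ (hs _ xr').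
    have /within_itv_epsP/(_ x xr' _ e20)[d d0 Hd] := hc.
    exists (Num.min e1 d); first by rewrite lt_min e10.
    move=> y yz; rewrite lt_min => /andP[y0 /andP[y1 y2]] /=.
    have yr' : p <= y <= r by lra.
    apply: He2; first exact: hs.
    rewrite normr_gt0 subr_eq0 He1//= ?y0//.
    by rewrite distrC Hd// distrC.
  - move=> E u1 u2 v1 v2 Ez Eh u12 uE zv v12 vr.
    have Ezr x : E x -> z <= x <= r by move=> /Ez; rewrite /= in_itv.
    (* Adding the image of [E] under [h] makes the set invariant under [h]; the added part lies left
       of [z], up to [z] itself, and so does not meet []v1, v2[]. *)
    have [|||||||x xv] := ht [set x | E x \/ exists2 y, E y & x = h y] u1 u2 v1 v2 => //; try lra.
    + move=> x [/Ezr xz|[y /Ezr yz ->]]; rewrite /= in_itv /=; first by lra.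
      by apply: hs; lra.
    + move=> x [xE|[y yE ->]]; first by right; exists x.
      by left; apply: Eh.
    + by move=> x xu; left; apply: uE.
    + move=> [|[y /Ezr/h_right yz xy]]; first by exists x.
      by rewrite -xy in yz; lra.
have [|z' [zz' _ _ Hl]] := trap_free_swap _ (mulr_ge0 L0 L0) LL4 HT; first by lra.
by have := Hl z; rewrite /= !hz; lra.
Qed.

End LipschitzTransitive.

(** * Transitive maps of the unit interval and their turning points *)

Section TransitiveMaps.
Variable R : realType.
Implicit Types (f g h : R -> R) (a b c p r x y z : R).

Lemma unit_itvE x : unit_itv R x = (0 <= x <= 1) :> Prop.
Proof. by rewrite /unit_itv /= in_itv. Qed.

Lemma finite_set_isolated (A : set R) x : finite_set A ->
  exists2 e, 0 < e & forall y, A y -> y != x -> e <= `|y - x|.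
Proof.
move=> /finite_seqP[s ->]; elim: s => [|a s [e e0 He]]; first by exists 1.
have [->|ax] := eqVneq a x.
  exists e => // y; rewrite /= inE => /orP[/eqP ->|ys yx]; first by rewrite eqxx.
  exact: He.
exists (Num.min e `|a - x|); first by rewrite lt_min e0 normr_gt0 subr_eq0.
move=> y; rewrite /= inE => /orP[/eqP ->|ys] yx; rewrite ge_min ?lexx ?orbT//.
by rewrite He.
Qed.

Lemma iter_self_map p r f n x : self_map p r f -> p <= x <= r -> p <= iter n f x <= r.
Proof. by move=> fs xpr; elim: n => //= n IH; apply: fs. Qed.

Lemma transitive_hit f (V : set R) u1 u2 : topologically_transitive f ->
  0 <= u1 -> u1 < u2 -> u2 <= 1 -> open V -> (exists x, V x /\ 0 <= x <= 1) ->
  exists n x, u1 < x < u2 /\ V (iter n f x).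
Proof.
move=> ft u0 u12 u1' Vo [v [Vv v01]].
have [||n [y [[x [xU _] <-] [yV _]]]] := ft `]u1, u2[%classic V (itv_open _ _) Vo.
- by exists ((u1 + u2) / 2); split; rewrite ?unit_itvE /= ?in_itv /=; lra.
- by exists v; split => //; rewrite unit_itvE.
by exists n, x; move: xU; rewrite /= in_itv.
Qed.

Lemma transitive_trap_free f : topologically_transitive f -> trap_free 0 1 f.
Proof.
move=> ft E u1 u2 v1 v2 E01 Ef u12 uE v10 v12 v21.
have E01' x : E x -> 0 <= x <= 1 by move=> /E01; rewrite /= in_itv.
have u10 : 0 <= u1.
  rewrite leNgt; apply/negP => u1n.
  have [m [m1 m2 m3]] : exists m, [/\ u1 < m, m < u2 & m < 0].
    have [u20|u20] := leP u2 0; first by exists ((u1 + u2) / 2); split; lra.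
    by exists (u1 / 2); split; lra.
  by have := E01' m (uE m _); lra.
have u21 : u2 <= 1.
  rewrite leNgt; apply/negP => u1n.
  have [m [m1 m2 m3]] : exists m, [/\ u1 < m, m < u2 & 1 < m].
    have [u20|u20] := leP 1 u1; first by exists ((u1 + u2) / 2); split; lra.
    by exists ((1 + u2) / 2); split; lra.
  by have := E01' m (uE m _); lra.
have [|n [x [xu xV]]] := transitive_hit ft u10 u12 u21 (itv_open v1 v2).
  by exists ((v1 + v2) / 2); rewrite /= in_itv /=; lra.
exists (iter n f x); first by move: xV; rewrite /= in_itv.
by elim: n {xV} => [|n IH] /=; [apply: uE|apply: Ef].
Qed.

Definition no_flat f := forall u v, 0 <= u -> u < v -> v <= 1 ->
  exists2 x, u <= x <= v & f x != f u.

(** If [f] is constantly [k] on [[u, v]], a passage from the left half to the right half shows that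
    the orbit of [k] returns to [[u, v]], hence is periodic. Points of the left half then only visit
    that finite orbit, which misses some interval []m, w[]. *)
Lemma transitive_no_flat f : self_map 0 1 f -> topologically_transitive f -> no_flat f.
Proof.
move=> fs ft u v u0 uv v1; apply: contrapT => flat.
have {}flat x : u <= x <= v -> f x = f u.
  by move=> xuv; apply/eqP; apply: contrapT => /negP fx; apply: flat; exists x.
set k := f u in flat; pose m := (u + v) / 2.
have um : u < m by rewrite /m; lra.
have mv : m < v by rewrite /m; lra.
have m1 : m <= 1 by lra.
have iterk n x : u < x < m -> iter n.+1 f x = iter n f k.
  by move=> xu; rewrite iterSr flat//; lra.
have [|n [x [xu]]] := transitive_hit ft u0 um m1 (itv_open m v).
  by exists ((m + v) / 2); rewrite /= in_itv /=; lra.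
rewrite /= in_itv /=; case: n => [|n]; first by rewrite /=; lra.
rewrite iterk// => kn.
have per : iter n.+1 f k = k by rewrite iterS flat//; lra.
have orb i : exists2 j, (j < n.+1)%N & iter i f k = iter j f k.
  elim: i => [|i [j jn ij]]; first by exists 0%N.
  have [jn'|jn'] := ltnP j.+1 n.+1; first by exists j.+1 => //; rewrite !iterS ij.
  have jE : j.+1 = n.+1 by apply/eqP; rewrite eqn_leq jn jn'.
  by exists 0%N => //; rewrite iterS ij -iterS jE per.
have fP : finite_set [set iter j f k | j in `I_n.+1].
  by apply: finite_image; exact: finite_II.
have [e e0 He] := finite_set_isolated m fP.
have [||w [mw wv we]] := @exists_between2 _ m v (m + e); [lra|lra|].
have [|i [y [yu]]] := transitive_hit ft u0 um m1 (itv_open m w).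
  by exists ((m + w) / 2); rewrite /= in_itv /=; lra.
rewrite /= in_itv /=; case: i => [|i]; first by rewrite /=; lra.
rewrite iterk//; have [j jn ->] := orb i => jw.
have : e <= `|iter j f k - m|.
  by apply: He; [exists j|rewrite gt_eqF//; lra].
by rewrite gtr0_norm; lra.
Qed.

(** If the minimum of [f] were positive, [[w, 1]] would be a trap for any smaller [w]; likewise at
    the maximum. The constant [1 / 2] keeps the trap nondegenerate. *)
Lemma transitive_surj f : self_map 0 1 f -> {within `[0, 1], continuous f} ->
  topologically_transitive f ->
  (exists2 x, 0 <= x <= 1 & f x = 0) /\ (exists2 x, 0 <= x <= 1 & f x = 1).
Proof.
move=> fs fc /transitive_trap_free ft; split.
- have [c c01 Hc] := evt_min fc (lexx 0) ler01 (lexx 1).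
  exists c => //; apply/eqP; rewrite eq_le andbC; have := fs _ c01 => /andP[-> _] /=.
  rewrite leNgt; apply/negP => fc1.
  have [||w [w0 wf w2]] := @exists_between2 _ 0 (f c) (1 / 2); [lra|lra|].
  have [|||||||x xw] := ft `[w, 1]%classic w 1 0 w; [| |lra| |lra|lra|lra|].
  + by move=> x; rewrite /= !in_itv /=; lra.
  + move=> x; rewrite /= !in_itv /= => xw; have := fs x; have := Hc x; lra.
  + by move=> x; rewrite /= in_itv /=; lra.
  + by rewrite /= in_itv /=; lra.
- have [c c01 Hc] := evt_max fc (lexx 0) ler01 (lexx 1).
  exists c => //; apply/eqP; rewrite eq_le; have := fs _ c01 => /andP[_ ->] /=.
  rewrite leNgt; apply/negP => fc1.
  have m0 : Num.max (f c) (1 / 2) < 1 by rewrite gt_max fc1; lra.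
  have m2 : f c <= Num.max (f c) (1 / 2) by rewrite le_max lexx.
  have m3 : 1 / 2 <= Num.max (f c) (1 / 2) by rewrite le_max lexx orbT.
  move: (Num.max _ _) m0 m2 m3 => w w0 wf w2.
  have [|||||||x xw] := ft `[0, w]%classic 0 w w 1; [| |lra| |lra|lra|lra|].
  + by move=> x; rewrite /= !in_itv /=; lra.
  + move=> x; rewrite /= !in_itv /= => xw; have := fs x; have := Hc x; lra.
  + by move=> x; rewrite /= in_itv /=; lra.
  + by rewrite /= in_itv /=; lra.
Qed.

Definition locally_monotone f x := exists2 e, 0 < e &
  (forall s t, x - e < s -> s <= t -> t < x + e -> f s <= f t) \/
  (forall s t, x - e < s -> s <= t -> t < x + e -> f t <= f s).

Lemma notCritP f x : 0 < x < 1 -> ~ Crit f x <-> locally_monotone f x.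
Proof.
move=> x01; split.
  move=> nC; have [U Ux Um] : exists2 U, nbhs x U & monotone_on (U `&` unit_itv R) f.
    apply: contrapT => H; apply: nC; right; split => //.
    by rewrite unit_itvE; lra.
  move: Ux => /nbhs_ballP[e /= e0 eU].
  have [|||d [d0 de dx dx1]] := @pos_lower_bound3 _ e x (1 - x); [lra|lra|lra|].
  have inU s : x - d < s -> s < x + d -> s \in U `&` unit_itv R.
    move=> xs sx; apply/mem_set; split; last by rewrite unit_itvE; lra.
    by apply: eU; rewrite /ball /= ltr_norml; lra.
  exists d => //; case: Um => Um; [left|right] => s t xs st tx.
    by apply: Um => //; apply: inU; lra.
  by apply: Um => //; apply: inU; lra.
move=> [e e0 He] [[/= x0|/= x1]|[_]]; [lra|lra|apply].
exists (ball x e); first exact: nbhsx_ballx.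
have inb s : s \in ball x e `&` unit_itv R -> x - e < s < x + e.
  by rewrite inE /= /ball /= => -[+ _]; rewrite ltr_norml; lra.
case: He => He; [left|right] => s t /inb si /inb ti st.
  by apply: He => //; lra.
by apply: He => //; lra.
Qed.

(** The maximum over [[x, z]] is attained at some interior [w], and local monotonicity at [w] then
    makes [f] constant on one side of [w]. *)
Lemma no_interior_max f u v x y z : {within `[0, 1], continuous f} -> no_flat f ->
  0 <= u -> v <= 1 -> (forall w, u < w < v -> locally_monotone f w) ->
  u <= x -> x < y -> y < z -> z <= v -> f x <= f y -> f z <= f y -> False.
Proof.
move=> fc nf u0 v1 fm ux xy yz zv fxy fzy.
have [w [w1 w2 Hw]] : exists w, [/\ x < w, w < z & forall t, x <= t <= z -> f t <= f w].
  have [|||c cxz Hc] := @evt_max _ f 0 1 x z fc; try lra.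
  have [cx|cx] := eqVneq c x.
    exists y; split => // t /Hc; rewrite cx; lra.
  have [cz|cz] := eqVneq c z.
    exists y; split => // t /Hc; rewrite cz; lra.
  exists c; split => //.
    by rewrite lt_neqAle eq_sym cx; lra.
  by rewrite lt_neqAle cz; lra.
have [e e0 He] : locally_monotone f w by apply: fm; lra.
have [|||d [d0 de dx dx1]] := @pos_lower_bound3 _ e (w - x) (z - w); [lra|lra|lra|].
case: He => He.
- have [|||t tw] := @nf w (w + d / 2); [lra|lra|lra|].
  rewrite neq_lt => /orP[|].
    by have := He w t; lra.
  by have := Hw t; lra.
- have [|||t tw] := @nf (w - d / 2) w; [lra|lra|lra|].
  have fl s : w - d / 2 <= s <= w -> f s = f w.
    move=> sw; apply/eqP; rewrite eq_le Hw ?He//; try lra.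
  by rewrite !fl ?eqxx//; lra.
Qed.

Lemma locally_monotone_opp f x : locally_monotone f x -> locally_monotone (fun t => - f t) x.
Proof.
move=> [e e0 He]; exists e => //; case: He => He; [right|left] => s t xs st tx;
  by rewrite lerN2 He.
Qed.

Lemma crit_free_between f u v x y z : {within `[0, 1], continuous f} -> no_flat f ->
  0 <= u -> v <= 1 -> (forall w, u < w < v -> ~ Crit f w) ->
  u <= x -> x < y -> y < z -> z <= v -> (f x < f y < f z) || (f z < f y < f x).
Proof.
move=> fc nf u0 v1 fm ux xy yz zv.
have {}fm w : u < w < v -> locally_monotone f w.
  by move=> wuv; apply/notCritP; [lra|exact: fm].
have H1 := @no_interior_max f u v x y z fc nf u0 v1 fm ux xy yz zv.
have : - f x <= - f y -> - f z <= - f y -> False.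
  apply: (@no_interior_max (fun t => - f t) u v x y z) => //.
  - by move=> t; apply: continuousN; apply: fc.
  - by move=> a b a0 ab b1; have [t tab ft] := nf a b a0 ab b1; exists t => //; rewrite eqr_opp.
  - by move=> w /fm /locally_monotone_opp.
rewrite !lerN2 => H2.
have [fxy|fxy|E] := ltgtP (f x) (f y); have [fzy|fzy|E'] := ltgtP (f z) (f y) => //=;
  by exfalso; first [apply: H1; lra|apply: H2; lra].
Qed.

Lemma crit_free_neq f u v x z : {within `[0, 1], continuous f} -> no_flat f ->
  0 <= u -> v <= 1 -> (forall w, u < w < v -> ~ Crit f w) ->
  u <= x -> x < z -> z <= v -> f x != f z.
Proof.
move=> fc nf u0 v1 fm ux xz zv.
have xy : x < (x + z) / 2 by lra.
have yz : (x + z) / 2 < z by lra.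
by have /orP[] := crit_free_between fc nf u0 v1 fm ux xy yz zv; rewrite neq_lt; lra.
Qed.

Lemma transitive_maps_light f : transitive_maps f -> light 0 1 f.
Proof.
move=> [fs fc ft fp] x x01.
have fs' : self_map 0 1 f by move=> t; rewrite -!unit_itvE => /fs.
have nf := transitive_no_flat fs' ft.
have [e e0 He] := finite_set_isolated x fp.
exists e => // y y01; have [yx|xy|->] := ltgtP y x; last by rewrite subrr normr0 ltxx.
- rewrite ltr0_norm ?subr_lt0// => xye.
  apply: (@crit_free_neq f y x) => //; try lra.
  move=> w yw Cw; have := He _ Cw; rewrite lt_eqF ?ltr0_norm; lra.
- rewrite gtr0_norm ?subr_gt0// eq_sym => xye.
  apply: (@crit_free_neq f x y) => //; try lra.
  move=> w yw Cw; have := He _ Cw; rewrite gt_eqF ?gtr0_norm; lra.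
Qed.

End TransitiveMaps.

(** * Constant slope models and the distribution functions of their conjugacies *)

Section ConstantSlope.
Variable R : realType.
Implicit Types (f g h psi phi : R -> R) (a b c p r x y z L : R).

Lemma modality_pigeonhole m n f (e : nat -> R) : has_modality m f ->
  (forall i, (i < n)%N -> Crit f (e i) /\ 0 < e i < 1) ->
  (forall i j, (i < n)%N -> (j < n)%N -> e i = e j -> i = j) -> (n <= m)%N.
Proof.
move=> fm eC einj; rewrite -card_le_II.
have /card_le_eql <- : ((e @` `I_n) #= `I_n)%card.
  by apply: inj_card_eq => i j; rewrite !inE /=; exact: einj.
rewrite -(card_le_eqr fm); apply: subset_card_le => _ [i /= ni <-].
by have [? ?] := eC _ ni; split; rewrite //= in_itv.
Qed.

Lemma constant_slope_segment h L x y : {within `[0, 1], continuous h} ->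
  has_constant_slope h L -> 0 <= x -> x < y -> y <= 1 ->
  (forall w, x < w < y -> ~ Crit h w) -> `|h x - h y| = L * (y - x).
Proof.
move=> hc hs x0 xy y1 nC.
have [w|c cxy] := @MVT _ h (derive1 h) x y xy _ (within_itvW x0 y1 hc).
  rewrite in_itv /= => wxy; rewrite derive1E; apply: derivableP.
  by have [] := hs w; [rewrite unit_itvE; lra|exact: nC|].
rewrite distrC => ->; rewrite normrM; move: cxy; rewrite in_itv /= => cxy.
have [|_ ->] := hs c _ (nC _ cxy); first by rewrite unit_itvE; lra.
by rewrite ger0_norm//; lra.
Qed.

Lemma constant_slope_lipschitz h L : transitive_maps h -> has_constant_slope h L ->
  lipschitz_itv L 0 1 h.
Proof.
move=> [_ hc _ hf] hs.
(* The mean value theorem only applies between turning points; the induction cuts [[x, y]] at the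
   elements of a list containing all turning points inside. *)
have H (l : seq R) x y : 0 <= x -> x <= y -> y <= 1 ->
    (forall w, x < w < y -> Crit h w -> w \in l) -> `|h x - h y| <= L * (y - x).
  elim: l x y => [|a l IH] x y x0 xy y1 Cl.
    have [->|xy'] := eqVneq x y; first by rewrite !subrr normr0 mulr0.
    rewrite (constant_slope_segment hc hs)//; first by rewrite lt_neqAle xy' xy.
    by move=> w /Cl H /H.
  have [axy|naxy] := boolP (x < a < y); last first.
    apply: IH => // w wxy Cw; have := Cl w wxy Cw; rewrite inE => /orP[/eqP wa|//].
    by move: naxy; rewrite -wa wxy.
  have -> : h x - h y = (h x - h a) + (h a - h y) by ring.
  have -> : L * (y - x) = L * (a - x) + L * (y - a) by ring.
  have Ha w : x < w < y -> w != a -> Crit h w -> w \in l.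
    by move=> wxy /negbTE wa Cw; have := Cl w wxy Cw; rewrite inE wa.
  have h1 : `|h x - h a| <= L * (a - x).
    apply: IH; try lra.
    by move=> w wxa Cw; apply: Ha; rewrite ?lt_eqF//; lra.
  have h2 : `|h a - h y| <= L * (y - a).
    apply: IH; try lra.
    by move=> w wxa Cw; apply: Ha; rewrite ?gt_eqF//; lra.
  by apply: le_trans (ler_normD _ _) _; lra.
have CH x y : 0 <= x -> x <= y -> y <= 1 -> `|h x - h y| <= L * (y - x).
  by have /finite_seqP[s Cs] := hf => x0 xy y1; apply: (H s) => // w _; rewrite Cs.
move=> x y xr yr; have [xy|xy] := leP x y.
  by rewrite [`|x - y|]distrC [`|y - x|]ger0_norm; [apply: CH|]; lra.
by rewrite distrC [`|x - y|]ger0_norm; [apply: CH|]; lra.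
Qed.

(* [phi] is the distribution function of a probability measure on [0,1] whose
   mass [g] multiplies by [L] on every interval without turning points. *)
Definition expanding_cdf L g phi :=
  [/\ forall x, x <= 0 -> phi x = 0, forall x, 1 <= x -> phi x = 1,
      forall x y, x <= y -> phi x <= phi y,
      forall x y, 0 <= x <= 1 -> 0 <= y <= 1 -> `|phi (g x) - phi (g y)| <= L * `|phi x - phi y|
    & forall x y, 0 <= x -> x < y -> y <= 1 -> (forall w, x < w < y -> ~ Crit g w) ->
        `|phi (g x) - phi (g y)| = L * (phi y - phi x)].

(** The expansion by [L] is stated inside [[0, 1]] only. Cutting a window about an endpoint down to
    [[0, 1]] does not change its mass. *)
Lemma expanding_cdf_clip L g phi q a : expanding_cdf L g phi -> 0 <= q <= 1 -> 0 < a ->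
  exists s t, [/\ [/\ 0 <= s, s < t & t <= 1], q - a <= s <= q, q <= t <= q + a,
    phi s = phi (q - a) & phi t = phi (q + a)].
Proof.
move=> [H0 H1 _ _ _] q01 a0.
have [qa|qa] := leP 0 (q - a); have [qa'|qa'] := leP (q + a) 1.
- by exists (q - a), (q + a); split => //; [split; lra|lra|lra].
- by exists (q - a), 1; split => //; [split; lra|lra|lra|rewrite !H1//; lra].
- by exists 0, (q + a); split => //; [split; lra|lra|lra|rewrite !H0//; lra].
- by exists 0, 1; split; [split; lra|lra|lra|rewrite !H0//; lra|rewrite !H1//; lra].
Qed.

(** The extension by 0 and 1 lets mass that gathers at an endpoint in the limit appear as a jump
    there. *)
Definition conj_cdf psi x := if x <= 0 then 0 else if 1 <= x then 1 else inv_itv psi x.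

Section Conjugacy.
Variables (g h psi : R -> R).
Hypothesis ghpsi : constant_slope_conjugacy g h psi.

Lemma hT : transitive_maps h. Proof. by case: ghpsi. Qed.
Lemma psi_homeo : increasing_homeo psi. Proof. by case: ghpsi. Qed.

Lemma psi01 x : 0 <= x <= 1 -> 0 <= psi x <= 1.
Proof. by case: psi_homeo => -[+ _ _] _ _ _; rewrite -!unit_itvE; apply. Qed.

Lemma psi_lt x y : 0 <= x -> x < y -> y <= 1 -> psi x < psi y.
Proof.
move=> x0 xy y1; case: psi_homeo => _ _ _; apply => //; rewrite inE unit_itvE; lra.
Qed.

Lemma psi_le x y : 0 <= x -> x <= y -> y <= 1 -> psi x <= psi y.
Proof.
move=> x0 xy y1; have [->//|nxy] := eqVneq x y.
by apply/ltW/psi_lt => //; rewrite lt_neqAle nxy.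
Qed.

Lemma psi_surj y : 0 <= y <= 1 -> exists2 x, 0 <= x <= 1 & psi x = y.
Proof.
case: psi_homeo => -[_ _ /(_ y)]; rewrite -unit_itvE => H _ _ _ /H [x].
by rewrite unit_itvE; exists x.
Qed.

Lemma psi0 : psi 0 = 0.
Proof.
have I0 : 0 <= (0 : R) <= 1 by lra.
have [x x01 psix] := psi_surj I0.
have := @psi_le 0 x; have := psi01 I0; lra.
Qed.

Lemma psi1 : psi 1 = 1.
Proof.
have I1 : 0 <= (1 : R) <= 1 by lra.
have [x x01 psix] := psi_surj I1.
have := @psi_le x 1; have := psi01 I1; lra.
Qed.

Lemma psiK x : 0 <= x <= 1 -> inv_itv psi (psi x) = x.
Proof.
move=> x01; case: psi_homeo => -[_ psi_inj _] _ _ _; apply: pinvKV => //.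
by rewrite inE unit_itvE.
Qed.

Lemma cdfK x : 0 <= x <= 1 -> conj_cdf psi (psi x) = x.
Proof.
move=> x01; rewrite /conj_cdf; have := psi01 x01; case: ifPn => [px|_].
  have [x0|x0] := leP x 0; first by lra.
  by have := @psi_lt 0 x; rewrite psi0; lra.
case: ifPn => [px|_]; last by rewrite psiK.
have [x1|x1] := leP 1 x; first by lra.
by have := @psi_lt x 1; rewrite psi1; lra.
Qed.

Lemma cdf_ge0_le1 y : 0 <= conj_cdf psi y <= 1.
Proof.
rewrite /conj_cdf; case: ifPn => y0; first by lra.
case: ifPn => y1; first by lra.
have [|x x01 <-] := @psi_surj y; first by lra.
by rewrite psiK.
Qed.

Lemma conjugacyK y : 0 <= y <= 1 -> psi (conj_cdf psi y) = y.
Proof. by move=> /psi_surj[x x01 <-]; rewrite cdfK. Qed.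

Lemma gpsi x : 0 <= x <= 1 -> g (psi x) = psi (h x).
Proof.
move=> x01; case: ghpsi => _ _ _ ->; first by rewrite /= psiK.
by rewrite inE unit_itvE psi01.
Qed.

Lemma h01 x : 0 <= x <= 1 -> 0 <= h x <= 1.
Proof. by case: hT => + _ _ _; rewrite -!unit_itvE; apply. Qed.

Lemma cdf_le x y : x <= y -> conj_cdf psi x <= conj_cdf psi y.
Proof.
have [y0|y0] := leP y 0.
  by move=> xy; rewrite /conj_cdf y0 ifT//; lra.
have [x0|x0] := leP x 0.
  by move=> _; rewrite {1}/conj_cdf x0; have := cdf_ge0_le1 y; lra.
have [y1|y1] := leP 1 y.
  by move=> _; rewrite {2}/conj_cdf y1 ifF; [have := cdf_ge0_le1 x; lra|lra].
move=> xy; have [|a a01 ax] := @psi_surj x; first by lra.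
have [|b b01 bY] := @psi_surj y; first by lra.
rewrite -ax -bY !cdfK// leNgt; apply/negP => ba.
by have := @psi_lt b a; rewrite ax bY; lra.
Qed.

Lemma cdf_lt x y : 0 <= x -> x < y -> y <= 1 -> conj_cdf psi x < conj_cdf psi y.
Proof.
move=> x0 xy y1; rewrite lt_neqAle cdf_le ?andbT; last by lra.
apply/negP => /eqP /(congr1 psi); rewrite !conjugacyK; lra.
Qed.

Lemma not_crit_cdf w : 0 < w < 1 -> ~ Crit g w -> ~ Crit h (conj_cdf psi w).
Proof.
move=> w01 /(notCritP g w01)[e e0 He].
have c0 : 0 < conj_cdf psi w.
  have -> : 0 = conj_cdf psi 0 by rewrite /conj_cdf lexx.
  by apply: cdf_lt; lra.
have c1 : conj_cdf psi w < 1.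
  have -> : 1 = conj_cdf psi 1 by rewrite /conj_cdf ler10 lexx.
  by apply: cdf_lt; lra.
have pc : psi (conj_cdf psi w) = w by rewrite conjugacyK; lra.
move: (conj_cdf psi w) pc c0 c1 => c pc c0 c1.
have c01 : 0 <= c <= 1 by lra.
have psic : {within `[0, 1], continuous psi} by case: psi_homeo.
have /within_itv_epsP/(_ c c01 _ e0)[d d0 Hd] := psic.
apply/notCritP; first by lra.
have [|||q [q0 qd qc qc1]] := @pos_lower_bound3 _ d c (1 - c); [lra|lra|lra|].
have psiw s : c - q < s < c + q -> w - e < psi s < w + e.
  move=> sc; have : `|psi c - psi s| < e.
    by apply: Hd; [lra|rewrite ltr_norml; lra].
  by rewrite pc ltr_norml; lra.
have hle s t : 0 <= s <= 1 -> 0 <= t <= 1 -> g (psi s) <= g (psi t) -> h s <= h t.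
  move=> s01 t01; rewrite !gpsi// => gst; rewrite leNgt; apply/negP => hts.
  by have := @psi_lt (h t) (h s); have := h01 s01; have := h01 t01; lra.
exists q => //; case: He => He; [left|right] => s t s1 st t1;
  (have s01 : 0 <= s <= 1 by lra); (have t01 : 0 <= t <= 1 by lra);
  (have ws : w - e < psi s < w + e by apply: psiw; lra);
  (have wt : w - e < psi t < w + e by apply: psiw; lra);
  (have pst : psi s <= psi t by apply: psi_le; lra).
- by apply: hle => //; apply: He; lra.
- by apply: hle => //; apply: He; lra.
Qed.

(** [conj_cdf psi] carries [g] to [h], so the two expansion clauses are the Lipschitz bound and the
    slope of [h]. *)
Lemma conjugacy_expanding_cdf L : has_constant_slope h L -> expanding_cdf L g (conj_cdf psi).
Proof.
move=> hs; have hL := constant_slope_lipschitz hT hs.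
have cdfg y : 0 <= y <= 1 -> conj_cdf psi (g y) = h (conj_cdf psi y).
  by move=> /psi_surj[x x01 <-]; rewrite gpsi// !cdfK// h01.
split.
- by move=> x x0; rewrite /conj_cdf x0.
- by move=> x x1; rewrite /conj_cdf x1 ifF//; apply/negbTE; rewrite -ltNge; lra.
- exact: cdf_le.
- by move=> x y x01 y01; rewrite !cdfg//; apply: hL; apply: cdf_ge0_le1.
- move=> x y x0 xy y1 nC; rewrite !cdfg; try lra.
  have hc : {within `[0, 1], continuous h} by case: hT.
  have cx := cdf_ge0_le1 x; have cy := cdf_ge0_le1 y.
  apply: constant_slope_segment => //; try lra; first exact: cdf_lt.
  move=> w wxy; have [|v v01 vw] := @psi_surj (psi w).
    by apply: psi01; lra.
  have w01 : 0 <= w <= 1 by lra.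
  rewrite -[w]cdfK//.
  have [xw wy] : x < psi w /\ psi w < y.
    split; rewrite ltNge; apply/negP => /cdf_le; rewrite cdfK//; lra.
  by apply: not_crit_cdf; [lra|apply: nC; lra].
Qed.

(** The constant is a number above 1 whose fourth power, here 1.4641, is below 2; what matters is
    that it is the same for all [g]. *)
Lemma conjugacy_slope_ge L : has_constant_slope h L -> 11 / 10 <= L.
Proof.
move=> hs; have hL := constant_slope_lipschitz hT hs.
have L0 : 0 <= L.
  have := hL 0 1; rewrite sub0r normrN normr1 mulr1 => H.
  by apply: le_trans (H _ _); rewrite ?lexx ?ler01.
have [hself _ ht _] := hT.
have H : 2 <= L ^+ 4.
  apply: (trap_free_lipschitz_ge ltr01 L0); split => //.
  - exact: h01.
  - exact: hL.
  - exact: transitive_maps_light hT.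
  - exact: transitive_trap_free.
have L4 : L ^+ 4 = (L * L) * (L * L) by ring.
rewrite leNgt; apply/negP => L11; have LL : L * L <= 121 / 100 by nra.
have LL0 : 0 <= L * L by exact: mulr_ge0.
nra.
Qed.

(** Cut [[0, 1]] into [m.+1] pieces of equal mass. The [m] turning points cannot meet all of their
    interiors, and a piece that they miss has an image of mass [L / m.+1], which is at most 1. *)
Lemma conjugacy_slope_le L m : has_modality m g -> has_constant_slope h L -> L <= m.+1%:R.
Proof.
move=> gm hs; have [_ _ _ _ HG2] := conjugacy_expanding_cdf hs.
have m0 : 0 < m.+1%:R :> R by rewrite ltr0n.
pose t i := psi (i%:R / m.+1%:R).
have ti i : (i <= m.+1)%N -> 0 <= (i%:R / m.+1%:R : R) <= 1.
  by move=> im; rewrite divr_ge0 ?ler0n//= ler_pdivrMr// mul1r ler_nat.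
have t01 i : (i <= m.+1)%N -> 0 <= t i <= 1 by move=> im; apply/psi01/ti.
have ct i : (i <= m.+1)%N -> conj_cdf psi (t i) = i%:R / m.+1%:R by move=> im; apply/cdfK/ti.
have tlt i j : (i < j)%N -> (j <= m.+1)%N -> t i < t j.
  move=> ij jm; apply: psi_lt.
  - by have /andP[] := ti i (leq_trans (ltnW ij) jm).
  - by rewrite ltr_pM2r ?invr_gt0// ltr_nat.
  - by have /andP[] := ti j jm.
have tle i j : (i <= j)%N -> (j <= m.+1)%N -> t i <= t j.
  by rewrite leq_eqVlt => /orP[/eqP ->//|ij jm]; apply/ltW/tlt.
have [[i im nC]|H] := pselect (exists2 i, (i < m.+1)%N & forall w, t i < w < t i.+1 -> ~ Crit g w).
  have := HG2 (t i) (t i.+1); rewrite (ct i.+1)// (ct i); last exact: ltnW.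
  have -> : i.+1%:R / m.+1%:R - i%:R / m.+1%:R = m.+1%:R^-1 :> R.
    by rewrite -mulrBl -natrB// subSnn mul1r.
  have := t01 i (ltnW im); have := t01 i.+1 im; have := tlt i i.+1 (leqnn _) im.
  move=> ? ? ? => /(_ _ _ _ nC) H.
  have := cdf_ge0_le1 (g (t i)); have := cdf_ge0_le1 (g (t i.+1)) => c1 c2.
  rewrite -(ler_pM2r (_ : 0 < m.+1%:R^-1)) ?invr_gt0// -H; try lra.
  rewrite divff ?gt_eqF// ler_norml; lra.
have {}H i : exists w, (i < m.+1)%N -> Crit g w /\ t i < w < t i.+1.
  have [im|] := ltnP i m.+1; last by exists 0.
  apply: contrapT => nw; apply: H; exists i => // w wi Cw; apply: nw.
  by exists w.
have [e He] := choice H.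
suff : (m.+1 <= m)%N by rewrite ltnn.
apply: (modality_pigeonhole (e := e) gm) => [i im|i j im jm eij].
  have [? ?] := He i im; have := t01 i (ltnW im); have := t01 i.+1 im.
  by split => //; lra.
have [ij|ij|//] := ltngtP i j.
- exfalso; have [_] := He i im; have [_] := He j jm; have := tle i.+1 j ij (ltnW jm); rewrite eij; lra.
- exfalso; have [_] := He i im; have [_] := He j jm; have := tle j.+1 i ij (ltnW im); rewrite eij; lra.
Qed.

End Conjugacy.
End ConstantSlope.

(** * Strict monotonicity, level crossings and finite sets *)

Section Monotone.
Variable R : realType.
Implicit Types (f g h psi phi : R -> R) (a b c d p q r x y z u v L : R).

Definition strict_mono f u v :=
  (forall x y, u <= x -> x < y -> y <= v -> f x < f y) \/
  (forall x y, u <= x -> x < y -> y <= v -> f y < f x).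

Lemma crit_free_mono f u v : {within `[0, 1], continuous f} -> no_flat f ->
  0 <= u -> u < v -> v <= 1 -> (forall w, u < w < v -> ~ Crit f w) -> strict_mono f u v.
Proof.
move=> fc nf u0 uv v1 fm; have bt := crit_free_between fc nf u0 v1 fm.
have := crit_free_neq fc nf u0 v1 fm (lexx u) uv (lexx v).
rewrite neq_lt => /orP[fuv|fvu]; [left|right] => x y ux xy yv.
- have [xu|xu] := eqVneq x u; have [yv'|yv'] := eqVneq y v.
  + by rewrite xu yv'.
  + by rewrite xu in xy *; have := bt u y v; rewrite !lexx !lt_neqAle yv' yv /=; lra.
  + have ux' : u < x by rewrite lt_neqAle eq_sym xu.
    by rewrite yv' in xy *; have := bt u x v (lexx _) ux' xy (lexx _); lra.
  + have ux' : u < x by rewrite lt_neqAle eq_sym xu.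
    have yv'' : y < v by rewrite lt_neqAle yv'.
    have := bt u x v (lexx _) ux' (lt_trans xy yv'') (lexx _).
    by have := bt u x y (lexx _) ux' xy yv; lra.
- have [xu|xu] := eqVneq x u; have [yv'|yv'] := eqVneq y v.
  + by rewrite xu yv'.
  + by rewrite xu in xy *; have := bt u y v; rewrite !lexx !lt_neqAle yv' yv /=; lra.
  + have ux' : u < x by rewrite lt_neqAle eq_sym xu.
    by rewrite yv' in xy *; have := bt u x v (lexx _) ux' xy (lexx _); lra.
  + have ux' : u < x by rewrite lt_neqAle eq_sym xu.
    have yv'' : y < v by rewrite lt_neqAle yv'.
    have := bt u x v (lexx _) ux' (lt_trans xy yv'') (lexx _).
    by have := bt u x y (lexx _) ux' xy yv; lra.
Qed.

Lemma strict_mono_opp f u v : strict_mono f u v -> strict_mono (fun x => - f x) u v.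
Proof.
by case=> H; [right|left] => x y ux xy yv; rewrite ltrN2; apply: H.
Qed.

Definition piecewise_strict_mono f := forall q, 0 < q < 1 ->
  exists e, [/\ 0 < e, 0 <= q - e, q + e <= 1, strict_mono f (q - e) q & strict_mono f q (q + e)].

Lemma transitive_maps_piecewise_strict_mono f : transitive_maps f -> piecewise_strict_mono f.
Proof.
move=> [fs fc ft fp] q q01.
have fs' : self_map 0 1 f by move=> t; rewrite -!unit_itvE => /fs.
have nf := transitive_no_flat fs' ft.
have [e e0 He] := finite_set_isolated q fp.
have [|||d [d0 de dq dq1]] := @pos_lower_bound3 _ e q (1 - q); [lra|lra|lra|].
exists d; split; try lra; apply: crit_free_mono => //; try lra.
- by move=> w wq /He; rewrite lt_eqF ?ltr0_norm; lra.
- by move=> w wq /He; rewrite gt_eqF ?gtr0_norm; lra.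
Qed.

(** Take the supremum [q] of the points of [[x0, x1]] below level [d]. Points below [d] accumulate
    at [q] from the left and none lies to its right, so [f] increases on both sides and [q] is not a
    turning point. *)
Lemma up_crossing f d x0 x1 : {within `[0, 1], continuous f} -> piecewise_strict_mono f ->
  0 <= x0 -> x0 < x1 -> x1 <= 1 -> f x0 < d -> d < f x1 ->
  exists q e, [/\ 0 < e, 0 <= q - e, q + e <= 1, f q = d & strict_mono f (q - e) (q + e)].
Proof.
move=> fc fm x00 x01 x11 fx0 fx1.
pose S := [set t | x0 <= t <= x1 /\ f t < d].
have S0 : S x0 by split => //; lra.
have hS : has_sup S by split; [exists x0|exists x1 => t []; lra].
set q := sup S.
have Sq t : S t -> t <= q by move=> St; apply: sup_upper_bound.
have q0 : x0 <= q by exact: Sq.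
have q1 : q <= x1 by apply: sup_le_ub; [exists x0|move=> t []; lra].
have above t : q < t -> t <= x1 -> d <= f t.
  by move=> qt tx; rewrite leNgt; apply/negP => ftd; have := Sq t; rewrite /S /=; lra.
have q01 : 0 <= q <= 1 by lra.
have /within_itv_epsP/(_ q q01) fcq := fc.
have fq : f q = d.
  apply/eqP; rewrite eq_le; apply/andP; split.
    rewrite leNgt; apply/negP => fqd.
    have [|e e0 He] := fcq (f q - d); first by lra.
    have [t St tq] := sup_adherent e0 hS; rewrite -/q in tq.
    have := Sq t St; case: St => tx ftd tq'.
    have : `|f q - f t| < f q - d by apply: He; [lra|rewrite ltr_norml; lra].
    by rewrite ltr_norml; lra.
  rewrite leNgt; apply/negP => fqd.
  have [|e e0 He] := fcq (d - f q); first by lra.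
  have qx1 : q < x1.
    by rewrite lt_neqAle q1 andbT; apply/negP => /eqP E; rewrite E in fqd; lra.
  have [||t [qt tx te]] := @exists_between2 _ q x1 (q + e / 2); [lra|lra|].
  have : `|f q - f t| < d - f q by apply: He; [lra|rewrite ltr_norml; lra].
  by have := above t qt tx; rewrite ltr_norml; lra.
have qx0 : x0 < q.
  by rewrite lt_neqAle q0 andbT; apply/negP => /eqP E; rewrite -E in fq; lra.
have qx1 : q < x1.
  by rewrite lt_neqAle q1 andbT; apply/negP => /eqP E; rewrite E in fq; lra.
have [|e [e0 qe0 qe1 ml mr]] := fm q; first by lra.
have ml' x y : q - e <= x -> x < y -> y <= q -> f x < f y.
  case: ml => ml; [exact: ml|exfalso].
  have [t [/= tx ftd] tq] := sup_adherent e0 hS; rewrite -/q in tq.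
  have := Sq t (conj tx ftd); rewrite le_eqVlt => /orP[/eqP tq'|tq']; first by rewrite tq' fq in ftd; lra.
  by have := ml t q (ltW tq) tq' (lexx q); rewrite fq; lra.
have mr' x y : q <= x -> x < y -> y <= q + e -> f x < f y.
  case: mr => mr; [exact: mr|exfalso].
  have [||t [qt tx te]] := @exists_between2 _ q x1 (q + e); [lra|lra|].
  by have := above t qt tx; have := mr q t (lexx q) qt te; rewrite fq; lra.
exists q, e; split => //; left => x y xq xy yq.
have [yq'|yq'] := leP y q; first exact: ml'.
have [xq'|xq'] := leP q x; first exact: mr'.
exact: lt_trans (ml' x q xq xq' (lexx q)) (mr' q y (lexx q) yq' yq).
Qed.

(** Being onto, [f] takes the values 0 and 1 and crosses [d] in between; a downward crossing is an
    upward one of [- f]. *)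
Lemma crossing f d : transitive_maps f -> 0 < d < 1 ->
  exists q e, [/\ 0 < e, 0 <= q - e, q + e <= 1, f q = d & strict_mono f (q - e) (q + e)].
Proof.
move=> fT d01; have fm := transitive_maps_piecewise_strict_mono fT.
have [fs fc ft fp] := fT.
have fs' : self_map 0 1 f by move=> t; rewrite -!unit_itvE => /fs.
have [[x0 x001 fx0] [x1 x101 fx1]] := transitive_surj fs' fc ft.
have [x01|x10|E] := ltgtP x0 x1; last by rewrite E fx1 in fx0; lra.
- by apply: (@up_crossing f d x0 x1) => //; lra.
- have [|||||||q [e [e0 q0 q1 fq mq]]] := @up_crossing (fun x => - f x) (- d) x1 x0; try lra.
  + by move=> t; apply: continuousN; apply: fc.
  + move=> q /fm[e [? ? ? /strict_mono_opp ? /strict_mono_opp ?]]; by exists e.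
  exists q, e; split => //; first by lra.
  have := strict_mono_opp mq; rewrite /strict_mono.
  by case=> H; [left|right] => x y ? ? ?; have := H x y; rewrite !opprK; apply.
Qed.

Lemma strict_mono_not_crit f q e : 0 < e -> 0 < q < 1 -> strict_mono f (q - e) (q + e) -> ~ Crit f q.
Proof.
move=> e0 q01 fm; apply/notCritP => //; exists e => //; case: fm => fm; [left|right] => s t s1 st t1.
- by have [->//|st'] := eqVneq s t; apply/ltW/fm; rewrite ?lt_neqAle ?st'//; lra.
- by have [->//|st'] := eqVneq s t; apply/ltW/fm; rewrite ?lt_neqAle ?st'//; lra.
Qed.

Lemma finite_set_separated (A : set R) : finite_set A ->
  exists2 e, 0 < e & forall x y, A x -> A y -> x != y -> e <= `|x - y|.
Proof.
move=> /finite_seqP[s ->]; elim: s => [|a s [e e0 He]]; first by exists 1.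
have [e' e'0 He'] := finite_set_isolated a (finite_seq s).
have m0 : 0 < Num.min e e' by rewrite lt_min e0.
have m1 : Num.min e e' <= e by rewrite ge_min lexx.
have m2 : Num.min e e' <= e' by rewrite ge_min lexx orbT.
exists (Num.min e e') => // x y; rewrite /= !inE => /orP[/eqP->|xs] /orP[/eqP->|ys].
- by rewrite eqxx.
- by rewrite eq_sym distrC => ya; apply: le_trans m2 (He' _ ys ya).
- by move=> ya; apply: le_trans m2 (He' _ xs ya).
- by move=> ya; apply: le_trans m1 (He _ _ xs ys ya).
Qed.

Lemma finite_set_argmin (A : set R) (w : R -> R) : finite_set A -> A !=set0 ->
  exists2 x, A x & forall y, A y -> w x <= w y.
Proof.
move=> /finite_seqP[s ->]; elim: s => [[//]|a s IH] _.
have [->|s0] := eqVneq s [::].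
  exists a; first by rewrite /= inE.
  by move=> y; rewrite /= inE => /eqP ->.
have [|x xs Hx] := IH; first by case: s s0 {IH} => // b s _; exists b; rewrite /= inE eqxx.
have [wax|wxa] := leP (w a) (w x).
- exists a; first by rewrite /= inE eqxx.
  by move=> y; rewrite /= inE => /orP[/eqP->//|/Hx]; apply: le_trans.
- exists x; first by rewrite /= inE xs orbT.
  by move=> y; rewrite /= inE => /orP[/eqP->|/Hx//]; apply: ltW.
Qed.

End Monotone.

(** * Points of increase and atoms of a nondecreasing function *)

Section Growth.
Variables (R : realType) (Phi : R -> R).
Hypothesis Phi_le : forall x y, x <= y -> Phi x <= Phi y.

(** The support of the measure with distribution function [Phi]; if it is finite, the measure is a
    sum of atoms. *)
Definition growth_point x := forall e, 0 < e -> Phi (x - e) < Phi (x + e).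

Lemma growth_point_between x y : x < y -> Phi x < Phi y ->
  exists2 d, growth_point d & x <= d <= y.
Proof.
move=> xy Pxy; pose S := [set t | x <= t <= y /\ Phi t = Phi x].
have Sx : S x by split => //; lra.
have hS : has_sup S by split; [exists x|exists y => t []; lra].
have q0 : x <= sup S by apply: sup_upper_bound.
have q1 : sup S <= y by apply: sup_le_ub; [exists x|move=> t []; lra].
exists (sup S); last by lra.
move=> e e0; apply: (@le_lt_trans _ _ (Phi x)).
  have [t [tx <-] tq] := sup_adherent e0 hS.
  by apply: Phi_le; lra.
have [ye|ye] := leP y (sup S + e); first by have := Phi_le ye; lra.
rewrite lt_neqAle Phi_le ?andbT; last by lra.
apply/negP => /eqP E; have : S (sup S + e) by split; [lra|rewrite -E].
by move=> /(sup_upper_bound hS); lra.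
Qed.

(** The jump of [Phi] across [x]. Two-sided windows keep out the value at [x] itself, over which a
    pointwise limit gives no control. *)
Definition atom x := inf [set Phi (x + e) - Phi (x - e) | e in [set e : R | 0 < e]].

Lemma atom_has_inf x : has_inf [set Phi (x + e) - Phi (x - e) | e in [set e : R | 0 < e]].
Proof.
split; first by exists (Phi (x + 1) - Phi (x - 1)), 1 => //=.
exists 0 => _ [e /= e0 <-]; rewrite subr_ge0; apply: Phi_le; lra.
Qed.

Lemma atom_le x e : 0 < e -> atom x <= Phi (x + e) - Phi (x - e).
Proof. by move=> e0; apply: ge_inf; [case: (atom_has_inf x)|exists e]. Qed.

Lemma le_atom x c : (forall e, 0 < e -> c <= Phi (x + e) - Phi (x - e)) -> c <= atom x.
Proof.
move=> H; apply: lb_le_inf; first by case: (atom_has_inf x).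
by move=> _ [e /= e0 <-]; exact: H.
Qed.

(** Finiteness isolates [x], so shrinking a window that holds no other growth point no longer
    changes its mass. *)
Lemma atom_gt0 x : finite_set growth_point -> growth_point x -> 0 < atom x.
Proof.
move=> fD Dx; have [e e0 He] := finite_set_isolated x fD.
have e2 : 0 < e / 2 by lra.
apply: (@lt_le_trans _ _ (Phi (x + e / 2) - Phi (x - e / 2))).
  by rewrite subr_gt0 Dx.
apply: le_atom => d d0; apply: lerB.
- rewrite leNgt; apply/negP => H.
  have [xd|xd] := leP (x + e / 2) (x + d); first by have := Phi_le xd; lra.
  have [c Dc cx] := growth_point_between xd H.
  have : e <= `|c - x| by apply: He => //; rewrite gt_eqF//; lra.
  by rewrite gtr0_norm; lra.
- rewrite leNgt; apply/negP => H.
  have [xd|xd] := leP (x - d) (x - e / 2); first by have := Phi_le xd; lra.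
  have [c Dc cx] := growth_point_between xd H.
  have : e <= `|c - x| by apply: He => //; rewrite lt_eqF//; lra.
  by rewrite ltr0_norm; lra.
Qed.

End Growth.

Lemma ultra_cvg (R : realType) (T : Type) (F : set_system T) (X : T -> R) : UltraFilter F ->
  (\forall g \near F, 0 <= X g <= 1) -> exists2 q : R, 0 <= q <= 1 & X g @[g --> F] --> q.
Proof.
move=> FU FX; have FP : ProperFilter F by exact: ultra_proper.
have [|q [q01 qc]] := @segment_compact R 0 1 (X @ F) _.
  by apply: filterS FX => g Xg; rewrite /= in_itv.
exists q; first by move: q01; rewrite /= in_itv.
move=> A Aq; have [//|FA] := in_ultra_setVsetC (X @^-1` A) FU.
have [y [nAy Ay]] := qc (~` A) A FA Aq.
by [].
Qed.

(** * The limit of the distribution functions along an ultrafilter *)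

Section Limit.
Variables (R : realType) (m : nat) (F : set_system (interval_maps R)).
Hypothesis FF : UltraFilter F.
Variables (f : R -> R) (phi : interval_maps R -> R -> R) (lam : interval_maps R -> R) (Phi : R -> R).
Hypothesis fT : transitive_maps_modality m f.
Hypothesis Fg : \forall g \near F, [/\ transitive_maps_modality m g,
  expanding_cdf (lam g) g (phi g) & 11 / 10 <= lam g <= m.+1%:R].
Hypothesis Ff : forall e : R, 0 < e -> \forall g \near F, forall x, 0 <= x <= 1 -> `|f x - g x| < e.
Hypothesis FPhi : forall x, phi g x @[g --> F] --> Phi x.

Let FP : ProperFilter F := @ultra_proper _ F FF.
Local Existing Instance FP.

Lemma limit_self_map x : 0 <= x <= 1 -> 0 <= f x <= 1.
Proof. by case: fT => -[+ _ _ _] _; rewrite -!unit_itvE; apply. Qed.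

Lemma limit_continuous : {within `[0, 1], continuous f}. Proof. by case: fT => -[]. Qed.

Lemma limit_transitive : topologically_transitive f. Proof. by case: fT => -[]. Qed.

Lemma limit_no_flat : no_flat f. Proof. by apply: transitive_no_flat; [exact: limit_self_map|exact: limit_transitive]. Qed.

Lemma limit_crit_finite : finite_set (Crit f). Proof. by case: fT => -[]. Qed.

Lemma Phi_lim C s t y1 y2 : (\forall g \near F, phi g y2 - phi g y1 <= C * (phi g t - phi g s)) ->
  Phi y2 - Phi y1 <= C * (Phi t - Phi s).
Proof.
move=> H.
have c1 : phi g y2 - phi g y1 @[g --> F] --> Phi y2 - Phi y1 by apply: cvgB; exact: FPhi.
have c2 : C * (phi g t - phi g s) @[g --> F] --> C * (Phi t - Phi s).
  by apply: cvgM; [exact: cvg_cst|apply: cvgB; exact: FPhi].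
apply: (ler_cvg_to c1 c2); exact: H.
Qed.

Lemma Phi_lim' C s t y1 y2 : (\forall g \near F, C * (phi g t - phi g s) <= phi g y2 - phi g y1) ->
  C * (Phi t - Phi s) <= Phi y2 - Phi y1.
Proof.
move=> H.
have c1 : phi g y2 - phi g y1 @[g --> F] --> Phi y2 - Phi y1 by apply: cvgB; exact: FPhi.
have c2 : C * (phi g t - phi g s) @[g --> F] --> C * (Phi t - Phi s).
  by apply: cvgM; [exact: cvg_cst|apply: cvgB; exact: FPhi].
apply: (ler_cvg_to c2 c1); exact: H.
Qed.

Lemma Phi_le x y : x <= y -> Phi x <= Phi y.
Proof.
move=> xy; apply: (ler_cvg_to (@FPhi x) (@FPhi y)).
by apply: filterS Fg => g [_ [_ _ H _ _] _]; apply: H.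
Qed.

Lemma Phi0 x : x <= 0 -> Phi x = 0.
Proof.
move=> x0; apply/eqP; rewrite eq_le; apply/andP; split.
- apply: (ler_cvg_to (@FPhi x) (cvg_cst (0 : R))).
  by apply: filterS Fg => g [_ [-> //]].
- apply: (ler_cvg_to (cvg_cst (0 : R)) (@FPhi x)).
  by apply: filterS Fg => g [_ [-> //]].
Qed.

Lemma Phi1 x : 1 <= x -> Phi x = 1.
Proof.
move=> x0; apply/eqP; rewrite eq_le; apply/andP; split.
- apply: (ler_cvg_to (@FPhi x) (cvg_cst (1 : R))).
  by apply: filterS Fg => g [_ [_ -> //]].
- apply: (ler_cvg_to (cvg_cst (1 : R)) (@FPhi x)).
  by apply: filterS Fg => g [_ [_ -> //]].
Qed.

Let D := growth_point Phi.

Lemma D01 x : D x -> 0 <= x <= 1.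
Proof.
move=> Dx; apply/andP; split; rewrite leNgt; apply/negP => H.
- by have := Dx (- x); rewrite !Phi0; lra.
- by have := Dx (x - 1); rewrite !Phi1; lra.
Qed.

(** The strict inequalities place [y1] and [y2] between [g s] and [g t] for [g] near [f], so their
    mass under [phi g] is at most [m.+1] times that between [s] and [t], which tends to 0. *)
Lemma Phi_image s t y1 y2 : 0 <= s <= 1 -> 0 <= t <= 1 -> Phi s = Phi t ->
  f s < y1 -> y1 <= y2 -> y2 < f t -> Phi y1 = Phi y2.
Proof.
move=> s01 t01 Pst fs1 y12 y2t.
pose e := Num.min (y1 - f s) (f t - y2).
have e0 : 0 < e by rewrite lt_min; apply/andP; split; lra.
have e1 : e <= y1 - f s by rewrite ge_min lexx.
have e2 : e <= f t - y2 by rewrite ge_min lexx orbT.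
have key g : (forall x, 0 <= x <= 1 -> `|f x - g x| < e) ->
    [/\ transitive_maps_modality m g, expanding_cdf (lam g) g (phi g) & 11 / 10 <= lam g <= m.+1%:R] ->
    phi g y2 - phi g y1 <= m.+1%:R * `|phi g s - phi g t|.
  move=> gf [_ [_ _ Hle HL _] lg].
  have := gf s s01; have := gf t t01; rewrite !ltr_norml => gft gfs.
  have h1 : phi g (g s) <= phi g y1 by apply: Hle; lra.
  have h2 : phi g y2 <= phi g (g t) by apply: Hle; lra.
  have := HL s t s01 t01; rewrite ler_norml => /andP[h3 _].
  have : lam g * `|phi g s - phi g t| <= m.+1%:R * `|phi g s - phi g t|.
    by apply: ler_wpM2r => //; lra.
  by lra.
apply/eqP; rewrite eq_le Phi_le//=.
have [st|ts] := leP s t.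
- suff : Phi y2 - Phi y1 <= m.+1%:R * (Phi t - Phi s) by rewrite Pst subrr mulr0; lra.
  apply: Phi_lim; apply: filterS2 (Ff e0) Fg => g gf gP.
  have := key g gf gP; case: gP => _ [_ _ Hle _ _] _.
  by rewrite distrC ger0_norm// subr_ge0 Hle.
- suff : Phi y2 - Phi y1 <= m.+1%:R * (Phi s - Phi t) by rewrite Pst subrr mulr0; lra.
  apply: Phi_lim; apply: filterS2 (Ff e0) Fg => g gf gP.
  have := key g gf gP; case: gP => _ [_ _ Hle _ _] _.
  by rewrite ger0_norm// subr_ge0 Hle// ltW.
Qed.

(* A limit of maps of the same modality creates no new turning points: each of
   the [m] turning points of [f] attracts one of [g], and these are all. *)
Lemma crit_free_stable q : 0 <= q <= 1 -> (0 < q < 1 -> ~ Crit f q) ->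
  exists2 e, 0 < e & \forall g \near F, forall w, q - e < w < q + e -> 0 < w < 1 -> ~ Crit g w.
Proof.
move=> q01 nCq; have [_ fm] := fT.
have /card_set_bijP[c [c1 c2 c3]] : (`I_m #= Crit f `&` `]0%R, 1%R[)%card by rewrite card_eq_sym.
have cC i : (i < m)%N -> Crit f (c i) /\ 0 < c i < 1.
  by move=> im; have [] := c1 i im; rewrite /= in_itv.
(* Since [Crit f] contains 0 and 1, windows of radius [d / 2] about the turning points are disjoint
   from each other and from the one about [q], and stay inside []0, 1[]. *)
have fA : finite_set (Crit f `|` [set q])
  by rewrite finite_setU; split; [exact: limit_crit_finite|exact: finite_set1].
have [d d0 Hd] := finite_set_separated fA.
have cinj i j : (i < m)%N -> (j < m)%N -> i != j -> d <= `|c i - c j|.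
  move=> im jm ij; apply: Hd; [by left; have [] := cC i im|by left; have [] := cC j jm|].
  by apply: contra ij => /eqP cij; apply/eqP; apply: c2; rewrite ?inE.
have cq i : (i < m)%N -> d <= `|c i - q|.
  move=> im; have [Ci ci] := cC i im; apply: Hd; [by left|by right|].
  by apply/negP => /eqP E; rewrite E in Ci ci; apply: nCq.
have c0 i : (i < m)%N -> d <= c i /\ d <= 1 - c i.
  move=> im; have [Ci ci] := cC i im; split.
    have <- : `|c i - 0| = c i by rewrite subr0 gtr0_norm; lra.
    by apply: Hd; [left|do 3 left|rewrite gt_eqF//; lra].
  have <- : `|c i - 1| = 1 - c i by rewrite ltr0_norm; lra.
  by apply: Hd; [left|left; left; right|rewrite lt_eqF//; lra].
have near_crit (i : 'I_m) : \forall g \near F, exists w, c i - d / 2 < w < c i + d / 2 /\ Crit g w.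
  have [Ci ci] := cC i (ltn_ord i); have [ci0 ci1] := c0 i (ltn_ord i).
  have nlm : ~ locally_monotone f (c i) by move=> /(notCritP f ci); apply.
  have [s1 [t1 [h1 h2 h3 h4]]] : exists s t, [/\ c i - d / 2 < s, s <= t, t < c i + d / 2 & f t < f s].
    apply: contrapT => H; apply: nlm; exists (d / 2); first by lra.
    left => s t h1 h2 h3; rewrite leNgt; apply/negP => h4; apply: H; by exists s, t.
  have [s2 [t2 [k1 k2 k3 k4]]] : exists s t, [/\ c i - d / 2 < s, s <= t, t < c i + d / 2 & f s < f t].
    apply: contrapT => H; apply: nlm; exists (d / 2); first by lra.
    right => s t h1' h2' h3'; rewrite leNgt; apply/negP => h4'; apply: H; by exists s, t.
  (* A map within [e] of [f] still has a descent from [s1] to [t1] and an ascent from [s2] to [t2],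
     so it cannot be monotone on the window. *)
  pose e := Num.min ((f s1 - f t1) / 2) ((f t2 - f s2) / 2).
  have e0 : 0 < e by rewrite lt_min; apply/andP; split; lra.
  have e1 : e <= (f s1 - f t1) / 2 by rewrite ge_min lexx.
  have e2 : e <= (f t2 - f s2) / 2 by rewrite ge_min lexx orbT.
  apply: filterS2 (Ff e0) Fg => g gf [[[gs gc gt gp] _] _ _].
  have gs' : self_map 0 1 g by move=> x; rewrite -!unit_itvE => /gs.
  have gn := transitive_no_flat gs' gt.
  apply: contrapT => nC.
  have [||||H|H] := @crit_free_mono _ g (c i - d / 2) (c i + d / 2) gc gn; [lra|lra|lra| | |].
  - by move=> w wc Cw; apply: nC; exists w.
  - have := gf s1; have := gf t1; rewrite !ltr_norml => g1 g2.
    have st : s1 < t1.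
      by rewrite lt_neqAle h2 andbT; apply/negP => /eqP E; rewrite E in h4; lra.
    by have := H s1 t1 (ltW h1) st (ltW h3); lra.
  - have := gf s2; have := gf t2; rewrite !ltr_norml => g1 g2.
    have st : s2 < t2.
      by rewrite lt_neqAle k2 andbT; apply/negP => /eqP E; rewrite E in k4; lra.
    by have := H s2 t2 (ltW k1) st (ltW k3); lra.
exists (d / 2); first by lra.
have {}near_crit : \forall g \near F, forall i : 'I_m, exists w, c i - d / 2 < w < c i + d / 2 /\ Crit g w.
  exact: filter_forall.
apply: filterS2 near_crit Fg => g gC [[_ gm] _ _] w wq w01 Cw.
have /choice[u Hu] : forall i, exists v, (i < m)%N -> c i - d / 2 < v < c i + d / 2 /\ Crit g v.
  move=> i; have [im|] := ltnP i m; last by exists 0.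
  by have [v Hv] := gC (Ordinal im); exists v.
suff : (m.+1 <= m)%N by rewrite ltnn.
(* Index [m] stands for the extra turning point [w], which would be the [m.+1]-st of [g]. *)
apply: (modality_pigeonhole (e := fun i => if (i < m)%N then u i else w) gm).
  move=> i _; case: ifPn => // im; have [ui ?] := Hu i im; split => //.
  by have := c0 i im; lra.
have uw i : (i < m)%N -> u i != w.
  move=> im; have [ui _] := Hu i im; have := cq i im; apply: contraTneq => E.
  by rewrite -ltNge ltr_norml; lra.
move=> i j im1 jm1; have [im|im] := ltnP i m; have [jm|jm] := ltnP j m.
- move=> E; apply/eqP; apply: contraT => ij.
  have := cinj i j im jm ij; have [ui _] := Hu i im; have [uj _] := Hu j jm.
  by rewrite leNgt ltr_norml E in ui *; lra.
- by move=> E; have := uw i im; rewrite E eqxx.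
- by move=> E; have := uw j jm; rewrite -E eqxx.
- move=> _; apply/eqP; rewrite eqn_leq; apply/andP; split.
    by apply: leq_trans jm; rewrite -ltnS.
  by apply: leq_trans im; rewrite -ltnS.
Qed.

(** A small window about [q] is free of turning points of all [g] near [f], so [g] multiplies its
    mass by at least [11 / 10], and the image stays within [e] of [f q]. At an endpoint the window
    is one-sided and cannot fold. *)
Lemma atom_image q : 0 <= q <= 1 -> (0 < q < 1 -> ~ Crit f q) ->
  11 / 10 * atom Phi q <= atom Phi (f q).
Proof.
move=> q01 nCq; apply: (le_atom Phi_le) => e e0.
have [d d0 Hd] := crit_free_stable q01 nCq.
have e20 : 0 < e / 2 by lra.
have /within_itv_epsP/(_ q q01 _ e20)[d' d'0 Hd'] := limit_continuous.
have [a [a0 ad ad']] : exists a, [/\ 0 < a, a < d & a < d'].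
  have [w [w0 wd wd']] := exists_between2 d0 d'0.
  by exists (w / 2); split; lra.
apply: (@le_trans _ _ (11 / 10 * (Phi (q + a) - Phi (q - a)))).
  by have := atom_le Phi_le q a0; lra.
apply: Phi_lim'; apply: filterS3 (Ff e20) Fg Hd => g gf [_ gexp lg] nC.
have [_ _ Hle _ HE] := gexp.
have [s [t [[s0 st t1] sq qt Ps Pt]]] := expanding_cdf_clip gexp q01 a0.
have fgs : `|f q - g s| < e.
  have -> : f q - g s = (f q - f s) + (f s - g s) by ring.
  have h1 : `|f q - f s| < e / 2 by apply: Hd'; [lra|rewrite ger0_norm; lra].
  have h2 : `|f s - g s| < e / 2 by apply: gf; lra.
  by apply: le_lt_trans (ler_normD _ _) _; lra.
have fgt : `|f q - g t| < e.
  have -> : f q - g t = (f q - f t) + (f t - g t) by ring.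
  have h1 : `|f q - f t| < e / 2 by apply: Hd'; [lra|rewrite ler0_norm; lra].
  have h2 : `|f t - g t| < e / 2 by apply: gf; lra.
  by apply: le_lt_trans (ler_normD _ _) _; lra.
have nCst w : s < w < t -> ~ Crit g w by move=> wst; apply: nC; lra.
have := HE s t s0 st t1 nCst; rewrite Ps Pt => E.
apply: (@le_trans _ _ (lam g * (phi g (q + a) - phi g (q - a)))).
  by apply: ler_wpM2r; [rewrite subr_ge0; apply: Hle|]; lra.
move: fgs fgt; rewrite !ltr_norml => fgs fgt.
have h1 : phi g (f q - e) <= phi g (g s) by apply: Hle; lra.
have h2 : phi g (f q - e) <= phi g (g t) by apply: Hle; lra.
have h3 : phi g (g s) <= phi g (f q + e) by apply: Hle; lra.
have h4 : phi g (g t) <= phi g (f q + e) by apply: Hle; lra.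
by rewrite -E ler_norml; lra.
Qed.

Lemma not_growth x y z : Phi x = Phi y -> x < z < y -> ~ D z.
Proof.
move=> Pxy xzy Dz; pose e := Num.min (z - x) (y - z).
have e0 : 0 < e by rewrite lt_min; apply/andP; split; lra.
have e1 : e <= z - x by rewrite ge_min lexx.
have e2 : e <= y - z by rewrite ge_min lexx orbT.
have := Dz e e0; have h1 : Phi x <= Phi (z - e) by apply: Phi_le; lra.
have h2 : Phi (z + e) <= Phi y by apply: Phi_le; lra.
by lra.
Qed.

(** * Preimages of growth points *)

Lemma not_growth_flat a b d : (forall y1 y2, a < y1 -> y1 <= y2 -> y2 < b -> Phi y1 = Phi y2) ->
  a < d < b -> ~ D d.
Proof.
by move=> H adb; apply: (@not_growth ((a + d) / 2) ((d + b) / 2)); [apply: H|]; lra.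
Qed.

(** Were [Phi] flat about [q], the image of a small interval about [q] would contain a neighborhood
    of [f q] on which [Phi] is flat, by [Phi_image]. *)
Lemma growth_preimage q e : 0 < e -> 0 <= q - e -> q + e <= 1 ->
  strict_mono f (q - e) (q + e) -> D (f q) -> D q.
Proof.
move=> e0 q0 q1 fm Dfq d d0; rewrite ltNge; apply/negP => H.
pose a := Num.min d e.
have a0 : 0 < a by rewrite lt_min d0.
have a1 : a <= d by rewrite ge_min lexx.
have a2 : a <= e by rewrite ge_min lexx orbT.
have Pa : Phi (q - a) = Phi (q + a).
  have h1 : Phi (q - d) <= Phi (q - a) by apply: Phi_le; lra.
  have h2 : Phi (q - a) <= Phi (q + a) by apply: Phi_le; lra.
  have h3 : Phi (q + a) <= Phi (q + d) by apply: Phi_le; lra.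
  by lra.
have qa0 : 0 <= q - a <= 1 by lra.
have qa1 : 0 <= q + a <= 1 by lra.
case: fm => fm.
- have h1 : f (q - a) < f q by apply: fm; lra.
  have h2 : f q < f (q + a) by apply: fm; lra.
  apply: (not_growth (x := (f (q - a) + f q) / 2) (y := (f (q + a) + f q) / 2) _ _ Dfq); last by lra.
  by apply: (Phi_image qa0 qa1 Pa); lra.
- have h1 : f q < f (q - a) by apply: fm; lra.
  have h2 : f (q + a) < f q by apply: fm; lra.
  apply: (not_growth (x := (f (q + a) + f q) / 2) (y := (f (q - a) + f q) / 2) _ _ Dfq); last by lra.
  by apply: (Phi_image qa1 qa0 (esym Pa)); lra.
Qed.

(** An arbitrary preimage of [d] under [f] will not do, since the maps [g] may fail to reach [d]
    near it. Hence [q] is a limit of preimages under the maps [g] themselves: images of windows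
    about [q] then reach [d], and flatness of [Phi] at [q] spreads to the inner side of [d]. The
    outer side carries no mass. *)
Lemma growth_preimage_end d : d = 0 \/ d = 1 -> D d -> exists q, [/\ 0 <= q <= 1, f q = d & D q].
Proof.
move=> d01 Dd.
(* The default 0 is never met along [F], where the maps are onto. *)
have /choice[X HX] : forall g : interval_maps R, exists x, (exists2 x, 0 <= x <= 1 & g x = d) ->
    0 <= x <= 1 /\ g x = d.
  move=> g; have [[x x01 gx]|n] := pselect (exists2 x, 0 <= x <= 1 & g x = d); first by exists x.
  by exists 0 => /n.
have FX : \forall g \near F, 0 <= X g <= 1 /\ g (X g) = d.
  apply: filterS Fg => g [[[gs gc gt gp] _] _ _]; apply: HX.
  have gs' : self_map 0 1 g by move=> x; rewrite -!unit_itvE => /gs.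
  by have [g0 g1] := transitive_surj gs' gc gt; case: d01 => ->.
have [q q01 qlim] : exists2 q : R, 0 <= q <= 1 & X g @[g --> F] --> q.
  by apply: ultra_cvg; apply: filterS FX => g [].
have Xq e : 0 < e -> \forall g \near F, `|q - X g| < e.
  by move=> e0; move/cvgrPdist_lt : qlim => /(_ e e0).
have fq : f q = d.
  apply/eqP; rewrite -subr_eq0 -normr_le0; apply/ler_addgt0Pr => e e0; rewrite add0r.
  have e20 : 0 < e / 2 by lra.
  have /within_itv_epsP/(_ q q01 _ e20)[c c0 Hc] := limit_continuous.
  have [g [[[X01 gX] qX] gf]] := filter_ex (filterI (filterI FX (Xq c c0)) (Ff e20)).
  have -> : f q - d = (f q - f (X g)) + (f (X g) - g (X g)) by rewrite gX; ring.
  have h1 := Hc _ X01 qX; have h2 := gf _ X01.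
  by apply: le_trans (ler_normD _ _) _; lra.
exists q; split => // e e0; rewrite ltNge; apply/negP => H.
have [s [s01 sq fsd]] : exists s, [/\ 0 <= s <= 1, `|q - s| < e & f s != d].
  have [u [v [[u0 uv v1] uq qv]]] : exists u v,
      [/\ [/\ 0 <= u, u < v & v <= 1], q - e / 2 <= u <= q & q <= v <= q + e / 2].
    have [qe|qe] := leP 0 (q - e / 2).
      by exists (q - e / 2), q; split; [split; lra|lra|lra].
    have [|v [v0 v1 ve]] := @exists_between2 _ 0 1 (q + e / 2) ltr01; first by lra.
    have [qv|vq] := leP q v; first by exists 0, v; split; [split; lra|lra|lra].
    by exists 0, q; split; [split; lra|lra|lra].
  have [x xuv fxu] := limit_no_flat u0 uv v1.
  have [fxd|fxd] := eqVneq (f x) d.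
    by exists u; split; [lra|rewrite ltr_norml; lra|rewrite -fxd eq_sym].
  by exists x; split; [lra|rewrite ltr_norml; lra|].
(* Halfway to [f s], so that [g s] lies beyond [y] as soon as [g] is within half of [|f s - d|] of
   [f]. *)
pose y := (f s + d) / 2.
have key : \forall g \near F, `|phi g d - phi g (g s)| <= m.+1%:R * (phi g (q + e) - phi g (q - e)).
  apply: filterS3 FX (Xq e e0) Fg => g [X01 gX] qX [_ [_ _ Hle HL _] lg].
  rewrite -{1}gX; apply: le_trans (HL _ _ X01 s01) _.
  apply: ler_pM => //; [lra|lra|].
  move: qX sq; rewrite !ltr_norml => qX sq.
  have h1 : phi g (q - e) <= phi g (X g) by apply: Hle; lra.
  have h2 : phi g (q - e) <= phi g s by apply: Hle; lra.
  have h3 : phi g (X g) <= phi g (q + e) by apply: Hle; lra.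
  have h4 : phi g s <= phi g (q + e) by apply: Hle; lra.
  by rewrite ler_norml; lra.
have b0 : 0 < `|f s - d| / 2 by rewrite divr_gt0// normr_gt0 subr_eq0.
have Pe : m.+1%:R * (Phi (q + e) - Phi (q - e)) <= 0.
  by rewrite pmulr_rle0 ?ltr0n// subr_le0.
have fs01 := limit_self_map s01.
case: d01 => dE.
- have ds : d < f s by rewrite dE lt_neqAle eq_sym -dE fsd dE; lra.
  have : Phi y - Phi d <= m.+1%:R * (Phi (q + e) - Phi (q - e)).
    apply: Phi_lim; apply: filterS3 (Ff b0) key Fg => g gf gk [_ [_ _ Hle _ _] _].
    have fsd' : `|f s - d| = f s - d by rewrite gtr0_norm; lra.
    move: (gf s s01); rewrite fsd' ltr_norml => gs; have : phi g y <= phi g (g s) by apply: Hle; rewrite /y; lra.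
    by move: gk; rewrite ler_norml; lra.
  have := Dd (y - d); have h : Phi (d - (y - d)) = Phi d by rewrite !Phi0; rewrite /y; lra.
  have -> : d + (y - d) = y by ring.
  by rewrite h /y => /(_ _); lra.
- have ds : f s < d by rewrite dE lt_neqAle -dE fsd dE; lra.
  have : Phi d - Phi y <= m.+1%:R * (Phi (q + e) - Phi (q - e)).
    apply: Phi_lim; apply: filterS3 (Ff b0) key Fg => g gf gk [_ [_ _ Hle _ _] _].
    have fsd' : `|f s - d| = d - f s by rewrite ltr0_norm; lra.
    move: (gf s s01); rewrite fsd' ltr_norml => gs; have : phi g (g s) <= phi g y by apply: Hle; rewrite /y; lra.
    by move: gk; rewrite ler_norml; lra.
  have := Dd (d - y); have h : Phi (d + (d - y)) = Phi d by rewrite !Phi1; rewrite /y; lra.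
  have -> : d - (d - y) = y by ring.
  by rewrite h /y => /(_ _); lra.
Qed.

Lemma limit_growth_infinite : ~ finite_set D.
Proof.
move=> fD; have D0 : D !=set0.
  have [|d Dd _] := @growth_point_between _ _ Phi_le 0 1 ltr01; last by exists d.
  by rewrite Phi0 ?Phi1.
(* A growth point of least mass has a preimage of smaller mass. *)
have min_contra (A : set R) : A !=set0 -> A `<=` D ->
    ~ forall d, A d -> exists q, [/\ A q, f q = d & (0 < q < 1 -> ~ Crit f q)].
  move=> A0 AD H; have [d Ad dmin] := finite_set_argmin (atom Phi) (sub_finite_set AD fD) A0.
  have [q [Aq fq nCq]] := H d Ad; have := atom_image (D01 (AD _ Aq)) nCq.
  by rewrite fq; have := dmin q Aq; have := atom_gt0 Phi_le fD (AD _ Ad); lra.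
have [[d Dd d01]|nD] := pselect (exists2 d, D d & 0 < d < 1).
- apply: (min_contra (D `&` [set x | 0 < x < 1])); [by exists d|by move=> x []|].
  move=> {d Dd d01} d [Dd /= d01].
  have [q [e [e0 q0 q1 fq fm]]] := crossing (proj1 fT) d01.
  have q01 : 0 < q < 1 by lra.
  exists q; split => //; last by move=> _; exact: strict_mono_not_crit fm.
  by split => //; apply: growth_preimage fm _; rewrite // fq.
- apply: (min_contra D) => // d Dd.
  have d01 : d = 0 \/ d = 1.
    have := D01 Dd; rewrite !le_eqVlt => /andP[/orP[/eqP->|d0]]; first by left.
    move=> /orP[/eqP->|d1]; first by right.
    by exfalso; apply: nD; exists d => //; lra.
  have [q [q01 fq Dq]] := growth_preimage_end d01 Dd.
  by exists q; split => // q01'; exfalso; apply: nD; exists q.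
Qed.

(** * Orbits of flat intervals *)

Lemma iter_limit_continuous n : {within `[0, 1], continuous (iter n f)}.
Proof.
elim: n => [|n /within_itv_epsP IH]; apply/within_itv_epsP => x x01 e e0.
  by exists e.
have /within_itv_epsP fc := limit_continuous.
have [d d0 Hd] := fc _ (iter_self_map n limit_self_map x01) e e0.
have [d' d'0 Hd'] := IH x x01 d d0; exists d' => // y y01 xy; rewrite !iterS.
by apply: Hd; [exact: iter_self_map limit_self_map y01|exact: Hd'].
Qed.

(** The induction hypothesis gives flatness only strictly between the two [n]-th iterates, whereas
    [Phi_image] asks for equal values at its two points. Continuity allows both points to be moved
    inward, by [pinch], without losing [y1] and [y2]. *)
Lemma flat_iter_image n l r : 0 <= l -> r <= 1 -> (forall x y, l < x -> x <= y -> y < r -> Phi x = Phi y) ->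
  forall s t y1 y2, l <= s <= r -> l <= t <= r ->
    iter n f s < y1 -> y1 <= y2 -> y2 < iter n f t -> Phi y1 = Phi y2.
Proof.
move=> l0 r1 H0; elim: n => [|n IH] s t y1 y2 sr tr.
  by move=> /= sy1 y12 y2t; apply: H0; lra.
rewrite !iterS => sy1 y12 y2t.
have s01 : 0 <= s <= 1 by lra.
have t01 : 0 <= t <= 1 by lra.
have := iter_self_map n limit_self_map s01; have := iter_self_map n limit_self_map t01.
move: (IH s t) (IH t s) sy1 y2t; move: (iter n f s) (iter n f t) => s' t' IH1 IH2 sy1 y2t t'01 s'01.
have /within_itv_epsP fc := limit_continuous.
have [|d1 d10 Hd1] := fc s' s'01 (y1 - f s'); first by lra.
have [|d2 d20 Hd2] := fc t' t'01 (f t' - y2); first by lra.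
have near_s u : 0 <= u <= 1 -> `|s' - u| < d1 -> f u < y1.
  by move=> u01 /(Hd1 u u01); rewrite ltr_norml; lra.
have near_t u : 0 <= u <= 1 -> `|t' - u| < d2 -> y2 < f u.
  by move=> u01 /(Hd2 u u01); rewrite ltr_norml; lra.
have [st|ts|st] := ltgtP s' t'; last by rewrite st in sy1; lra.
- have [u [v [su uv vt us tv]]] := pinch st d10 d20.
  have u01 : 0 <= u <= 1 by lra.
  have v01 : 0 <= v <= 1 by lra.
  have fu : f u < y1 by apply: near_s => //; rewrite ltr_norml; lra.
  have fv : y2 < f v by apply: near_t => //; rewrite ltr_norml; lra.
  have Puv : Phi u = Phi v by apply: (IH1 _ _ sr tr su (ltW uv) vt).
  exact: (Phi_image u01 v01 Puv fu y12 fv).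
- have [v [u [tv vu us vt su]]] := pinch ts d20 d10.
  have u01 : 0 <= u <= 1 by lra.
  have v01 : 0 <= v <= 1 by lra.
  have fu : f u < y1 by apply: near_s => //; rewrite ltr_norml; lra.
  have fv : y2 < f v by apply: near_t => //; rewrite ltr_norml; lra.
  have Pvu : Phi v = Phi u by apply: (IH2 _ _ tr sr tv (ltW vu) us).
  exact: (Phi_image u01 v01 (esym Pvu) fu y12 fv).
Qed.

(* The maximal flat interval [l,r] of [Phi] is mapped into itself by some
   iterate of [f]; its orbit is then a finite union of flat intervals, which is
   dense by transitivity, so that only their endpoints can be growth points. *)
Lemma limit_growth_finite j1 j2 : 0 <= j1 -> j1 < j2 -> j2 <= 1 -> Phi j1 = Phi j2 -> finite_set D.
Proof.
move=> j10 j12 j21 Pj.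
have [l [r [[l0 r1 lj jr] flat Smem]]] : exists l r, [/\ [/\ 0 <= l, r <= 1, l <= j1 & j2 <= r],
    forall x, l < x < r -> Phi x = Phi j1
  & forall x, 0 <= x <= 1 -> Phi x = Phi j1 -> l <= x <= r].
  pose S := [set x | 0 <= x <= 1 /\ Phi x = Phi j1].
  have Sj1 : S j1 by split => //; lra.
  have Sj2 : S j2 by split => //; lra.
  have sS : has_sup S by split; [exists j1|exists 1 => x []; lra].
  have iS : has_inf S by split; [exists j1|exists 0 => x []; lra].
  have Sr x : S x -> x <= sup S by move=> Sx; apply: sup_upper_bound.
  have Sl x : S x -> inf S <= x by move=> Sx; apply: ge_inf => //; case: iS.
  have r1 : sup S <= 1 by apply: sup_le_ub; [exists j1|move=> x []; lra].
  have l0 : 0 <= inf S by apply: lb_le_inf; [exists j1|move=> x []; lra].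
  have flat x : inf S < x < sup S -> Phi x = Phi j1.
    move=> /andP[lx xr]; have d1 : 0 < x - inf S by lra.
    have d2 : 0 < sup S - x by lra.
    have [a [a01 Pa] ax] := inf_adherent d1 iS.
    have [b [b01 Pb] bx] := sup_adherent d2 sS.
    have h1 : Phi a <= Phi x by apply: Phi_le; lra.
    have h2 : Phi x <= Phi b by apply: Phi_le; lra.
    by lra.
  have lj := Sl _ Sj1; have jr := Sr _ Sj2.
  have Smem x : 0 <= x <= 1 -> Phi x = Phi j1 -> inf S <= x <= sup S.
    by move=> x01 Px; rewrite Sl ?Sr.
  by exists (inf S), (sup S).
have lr : l <= r by lra.
have H0 x y : l < x -> x <= y -> y < r -> Phi x = Phi y by move=> lx xy yr; rewrite !flat//; lra.
have H n := flat_iter_image (n := n) l0 r1 H0.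
pose mid := (j1 + j2) / 2.
have jm : j1 < mid by rewrite /mid; lra.
have mj : mid < j2 by rewrite /mid; lra.
have m1 : mid <= 1 by lra.
(* Source and target are disjoint halves of []j1, j2[], which excludes a return at time 0. *)
have [|n [x [xj]]] := transitive_hit limit_transitive j10 jm m1 (itv_open mid j2).
  by exists ((mid + j2) / 2); rewrite /= in_itv /=; lra.
rewrite /= in_itv /= => fnx.
have n0 : (0 < n)%N by case: n fnx => //= fnx; lra.
have xlr : l <= x <= r by lra.
have lr01 s : l <= s <= r -> 0 <= s <= 1 by lra.
(* The image of [[l, r]] under the iterate meets []l, r[]. If it also left [[l, r]], flatness would
   extend the level of [Phi] beyond [l] or [r], against maximality. *)
have ret s : l <= s <= r -> l <= iter n f s <= r.
  move=> slr; have := iter_self_map n limit_self_map (lr01 s slr).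
  have := H n s x; have := H n x s.
  move: (iter n f x) (iter n f s) fnx => y w yj H1 H2 w01; apply/andP; split; rewrite leNgt; apply/negP => wlr.
  - have := H2 ((w + l) / 2) ((j1 + y) / 2) slr xlr.
    rewrite (flat ((j1 + y) / 2)); last by lra.
    have w'01 : 0 <= (w + l) / 2 <= 1 by lra.
    move=> E; have /(Smem _ w'01) : Phi ((w + l) / 2) = Phi j1 by apply: E; lra.
    by lra.
  - have := H1 ((j2 + y) / 2) ((w + r) / 2) xlr slr.
    rewrite (flat ((j2 + y) / 2)); last by lra.
    have w'01 : 0 <= (w + r) / 2 <= 1 by lra.
    move=> E; have /(Smem _ w'01) : Phi ((w + r) / 2) = Phi j1 by apply/esym/E; lra.
    by lra.
have orb j s : l <= s <= r -> exists i s', [/\ (i < n)%N, l <= s' <= r & iter j f s = iter i f s'].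
  move=> slr; elim: j => [|j [i [s' [im s'lr E]]]]; first by exists 0%N, s.
  have [im'|im'] := ltnP i.+1 n; first by exists i.+1, s'; split => //; rewrite !iterS E.
  have iE : i.+1 = n by apply/eqP; rewrite eqn_leq im im'.
  by exists 0%N, (iter n f s'); split; rewrite ?ret// iterS E -iterS iE.
have /choice[u Hu] : forall i, exists s, l <= s <= r /\ forall t, l <= t <= r -> iter i f s <= iter i f t.
  by move=> i; have [s] := evt_min (@iter_limit_continuous i) l0 lr r1; exists s.
have /choice[v Hv] : forall i, exists s, l <= s <= r /\ forall t, l <= t <= r -> iter i f t <= iter i f s.
  by move=> i; have [s] := evt_max (@iter_limit_continuous i) l0 lr r1; exists s.
(* The extreme values of the [n] images of [[l, r]], that is, the endpoints of the flat
   intervals. *)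
pose E := [set iter i f (u i) | i in `I_n] `|` [set iter i f (v i) | i in `I_n].
have fE : finite_set E.
  by rewrite finite_setU; split; apply: finite_image; exact: finite_II.
apply: (sub_finite_set _ fE) => d Dd; apply: contrapT => nE.
have [e e0 He] := finite_set_isolated d fE.
have d01 := D01 Dd.
(* Some image of [[l, r]] comes within [e] of [d], while its endpoints are at least [e] away; hence
   [d] is interior to it. *)
have [|k [y [yj]]] := transitive_hit limit_transitive j10 j12 j21 (itv_open (d - e) (d + e)).
  by exists d; rewrite /= in_itv /=; lra.
rewrite /= in_itv /=; have [|i [s [im slr ->]]] := orb k y; first by lra.
have [ulr umin] := Hu i; have [vlr vmax] := Hv i; have := umin s slr; have := vmax s slr.
have Eu : E (iter i f (u i)) by left; exists i.
have Ev : E (iter i f (v i)) by right; exists i.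
have ud : iter i f (u i) != d by apply/negP => /eqP ude; apply: nE; rewrite -ude.
have vd : iter i f (v i) != d by apply/negP => /eqP ude; apply: nE; rewrite -ude.
have := He _ Eu ud; have := He _ Ev vd.
have := H i (u i) (v i).
move: (iter i f (u i)) (iter i f (v i)) ud vd => a b ad bd Hab hb ha sb sa sd.
have ad' : a < d.
  rewrite ltNge; apply/negP => da; clear Hab hb umin vmax.
  by rewrite ger0_norm in ha; lra.
have db' : d < b.
  rewrite ltNge; apply/negP => db; clear Hab ha umin vmax.
  by rewrite ler0_norm in hb; lra.
by apply: (not_growth_flat (fun y1 y2 => Hab y1 y2 ulr vlr) _ Dd); rewrite ad'.
Qed.

Lemma limit_cdf_strict x y : 0 <= x -> x < y -> y <= 1 -> Phi x < Phi y.
Proof.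
move=> x0 xy y1; rewrite lt_neqAle Phi_le ?andbT; last exact: ltW.
by apply/negP => /eqP /(limit_growth_finite x0 xy y1); exact: limit_growth_infinite.
Qed.

End Limit.

(** * Equicontinuity of the conjugacies *)

Lemma Psi_equicontinuous_at (R : realType) (m : nat) (K : set (interval_maps R)) (x0 eps : R) :
  compact K -> K `<=` @transitive_maps_modality R m -> 0 <= x0 <= 1 -> 0 < eps ->
  exists2 d, 0 < d & forall g, K g -> forall y, 0 <= y <= 1 -> `|x0 - y| < d ->
    `|Psi g x0 - Psi g y| < eps.
Proof.
move=> Kc KT x01 eps0; apply: contrapT => neq.
pose B (d : R) : set (interval_maps R) := [set g | K g /\ exists y,
  [/\ 0 <= y <= 1, `|x0 - y| < d & eps <= `|Psi g x0 - Psi g y|]].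
have B0 d : 0 < d -> B d !=set0.
  move=> d0; apply: contrapT => nB; apply: neq; exists d => // g Kg y y01 xy.
  by rewrite ltNge; apply/negP => H; apply: nB; exists g; split => //; exists y.
have Bsub d d' : d <= d' -> B d `<=` B d'.
  by move=> dd' g [Kg [y [y01 xy e]]]; split => //; exists y; split => //; apply: lt_le_trans dd'.
have [F [FU FB]] : exists F, UltraFilter F /\ filter_from [set d : R | 0 < d] B `<=` F.
  apply: ultraFilterLemma; apply: filter_from_proper; last exact: B0.
  apply: filter_from_filter; first by exists 1 => /=.
  move=> i j /= i0 j0; exists (Num.min i j); first by rewrite /= lt_min i0.
  by move=> g Bg; split; apply: Bsub Bg; rewrite ge_min lexx ?orbT.
have FP : ProperFilter F by exact: ultra_proper.
have {}FB d : 0 < d -> \forall g \near F, B d g by move=> d0; apply: FB; exists d.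
have FK : F K by apply: filterS (FB 1 ltr01) => g [].
move: Kc; rewrite compact_ultra => /(_ F FU FK)[f [Kf Ff]].
have Ff' (e : R) : 0 < e -> \forall g \near F, forall x, 0 <= x <= 1 -> `|f x - g x| < e.
  move=> e0; apply: Ff; apply/uniform_nbhs.
  exists [set xy | ball xy.1 e xy.2]; split; first exact: (entourage_ball _ (PosNum e0)).
  by move=> g /= gf x x01'; apply: gf; rewrite unit_itvE.
(* If [g] had no conjugacy, [Psi g] would be [id], which cannot separate by [eps] two points less
   than [eps] apart; so [g] would not lie in [B eps]. *)
have conj_near : \forall g \near F, exists h L, constant_slope_conjugacy g h (Psi g) /\ has_constant_slope h L.
  apply: filterS (FB eps eps0) => g [Kg [y [y01 xy H]]].
  have [ex|nex] := pselect (exists psi, exists h, constant_slope_conjugacy g h psi).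
    have [h hg] : exists h, constant_slope_conjugacy g h (Psi g) by exact: (xgetPex _ ex).
    have [_ [L hL] _ _] := hg.
    by exists h, L.
  have E : Psi g = id by apply: xgetPN => psi psiP; apply: nex; exists psi.
  by move: H; rewrite E /=; lra.
have /choice[lam Hlam] : forall g : interval_maps R, exists L,
    (exists h L, constant_slope_conjugacy g h (Psi g) /\ has_constant_slope h L) ->
    exists2 h, constant_slope_conjugacy g h (Psi g) & has_constant_slope h L.
  move=> g; have [[h [L [gh hL]]]|n] := pselect (exists h L,
    constant_slope_conjugacy g h (Psi g) /\ has_constant_slope h L); first by exists L => _; exists h.
  by exists 0 => /n.
pose phi (g : interval_maps R) := conj_cdf (Psi g).
have Fg : \forall g \near F, [/\ transitive_maps_modality m g,
    expanding_cdf (lam g) g (phi g) & 11 / 10 <= lam g <= m.+1%:R].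
  apply: filterS2 conj_near FK => g /Hlam[h gh hL] /KT gT; split => //.
    exact: conjugacy_expanding_cdf gh _ hL.
  by rewrite (conjugacy_slope_ge gh hL) (conjugacy_slope_le gh (proj2 gT) hL).
have /choice[Phi HPhi] : forall x, exists l : R, phi g x @[g --> F] --> l.
  move=> x; have [|l _ Hl] := @ultra_cvg R _ F (fun g => phi g x) FU; last by exists l.
  by apply: filterS conj_near => g [h [L [gh _]]]; exact: (cdf_ge0_le1 gh).
have [|p p01 Hp] := @ultra_cvg R _ F (fun g => Psi g x0) FU.
  by apply: filterS conj_near => g [h [L [gh _]]]; exact: (psi01 gh).
have Pstrict := limit_cdf_strict FU (KT f Kf) Fg Ff' HPhi.
have Pgap x y : 0 <= x -> x < y -> exists2 c, 0 < c & y <= 1 -> c <= Phi y - Phi x.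
  move=> x00 xy; have [y1|y1] := leP y 1; last by exists 1 => //; lra.
  by exists (Phi y - Phi x) => //; rewrite subr_gt0 Pstrict.
(* Once [Psi g x0] is within [eps / 3] of [p], a value [Psi g y] at distance [eps] or more from it
   lies beyond [p + 2 * eps / 3] or [p - 2 * eps / 3]. The points [x0] and [y] are then separated by
   the [phi g]-mass of a fixed interval of length [eps / 3]. This exceeds [c / 2], as two errors of
   [c / 4] are lost from [c]. If the interval leaves [[0, 1]], that side cannot occur. *)
have [c1 c10 Hc1] : exists2 c, 0 < c & p + 2 * eps / 3 <= 1 ->
    c <= Phi (p + 2 * eps / 3) - Phi (p + eps / 3) by apply: Pgap; lra.
have [c2 c20 Hc2] : exists2 c, 0 < c & 0 <= p - 2 * eps / 3 ->
    c <= Phi (p - eps / 3) - Phi (p - 2 * eps / 3).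
  have [pe|pe] := leP 0 (p - 2 * eps / 3); last by exists 1 => //; lra.
  have [||c c0 Hc] := Pgap (p - 2 * eps / 3) (p - eps / 3); [lra|lra|].
  by exists c => // _; apply: Hc; lra.
pose c := Num.min c1 c2.
have c0 : 0 < c by rewrite lt_min c10.
have cc1 : c <= c1 by rewrite ge_min lexx.
have cc2 : c <= c2 by rewrite ge_min lexx orbT.
have near_phi x : \forall g \near F, `|Phi x - phi g x| < c / 4.
  by move/cvgrPdist_lt : (HPhi x); apply; lra.
have near_p : \forall g \near F, `|p - Psi g x0| < eps / 3.
  by move/cvgrPdist_lt : Hp; apply; lra.
have c20' : 0 < c / 2 by lra.
have [g []] := filter_ex (filterI (filterI (filterI (filterI (filterI (filterI (FB _ c20') conj_near) near_p)
  (near_phi (p + 2 * eps / 3))) (near_phi (p + eps / 3))) (near_phi (p - eps / 3))) (near_phi (p - 2 * eps / 3))).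
move=> [[[[[[Kg [y [y01 xy Hy]]] [h [L [gh hL]]]] np] n1] n2] n3] n4.
have [_ _ Hle _ _] := conjugacy_expanding_cdf gh hL; rewrite -/(phi g) in Hle.
have phix0 : phi g (Psi g x0) = x0 by exact: (cdfK gh).
have phiy : phi g (Psi g y) = y by exact: (cdfK gh).
have Py := psi01 gh y01.
move: n1 n2 n3 n4 np xy; rewrite !ltr_norml => n1 n2 n3 n4 np xy.
move: Hy; rewrite ler_normr => /orP[Hy|Hy].
- have h1 : phi g (Psi g y) <= phi g (p - 2 * eps / 3) by apply: Hle; lra.
  have h2 : phi g (p - eps / 3) <= phi g (Psi g x0) by apply: Hle; lra.
  by have := Hc2; rewrite phix0 in h2; rewrite phiy in h1; lra.
- have h1 : phi g (p + 2 * eps / 3) <= phi g (Psi g y) by apply: Hle; lra.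
  have h2 : phi g (Psi g x0) <= phi g (p + eps / 3) by apply: Hle; lra.
  by have := Hc1; rewrite phix0 in h2; rewrite phiy in h1; lra.
Qed.

Theorem theorem2 (R : realType) (m : nat) (K : set (interval_maps R)) :
  compact K -> K `<=` @transitive_maps_modality R m ->
  equicontinuous ((@Psi R) @` K : set (subspace (unit_itv R) -> R)) id.
Proof.
move=> Kc KT x E; rewrite -entourage_from_ballE => -[e /= e0 Ee].
have [x01|nx01] := pselect (unit_itv R x).
- have x01' := x01; rewrite unit_itvE in x01'.
  have [d d0 Hd] := Psi_equicontinuous_at Kc KT x01' e0.
  change (nbhs_subspace (A := unit_itv R) x [set y | forall i : R -> R, (Psi (R := R) @` K) i -> E (i x, i y)]).
  rewrite -nbhs_subspace_in//; apply/nbhs_ballP; exists d => // y xy y01 _ [g Kg <-].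
  by apply: Ee => /=; apply: Hd => //; rewrite -unit_itvE.
(* Points outside [[0, 1]] are isolated in the subspace topology. *)
- change (nbhs_subspace (A := unit_itv R) x [set y | forall i : R -> R, (Psi (R := R) @` K) i -> E (i x, i y)]).
  rewrite -nbhs_subspace_out// => _ -> i _; apply: Ee; exact: ballxx.
Qed.
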